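(* Let $(\Sigma,\sigma)$ be a topologically transitive countable Markov shift with alphabet $\mathbb{N}$, let $\phi:\Sigma\to\mathbb{R}$ be a potential with summable variations such that $P(\phi)<\infty$, and suppose that the entropy at infinity satisfies $h_\infty=0$. Then $$\chi_{per}(\phi):=\sup\left\{\tfrac1n S_n\phi(x): x\in\Sigma,\ n\in\mathbb{N},\ \sigma^n(x)=x\right\}<P(\phi)$$ holds if and only if $(\Sigma,\sigma,\phi)$ is strongly positive recurrent (SPR).
   Context: Countable Markov shift: given an alphabet $\mathcal{A}=\mathbb{N}=\{1,2,\dots\}$ and a $0$-$1$ transition matrix $M=(M_{i,j})_{i,j\in\mathcal{A}}$, set $\Sigma=\{(x_0,x_1,\dots)\in\mathcal{A}^{\mathbb{N}_0}: M_{x_i,x_{i+1}}=1\ \forall i\ge0\}$ with shift $\sigma(x_0,x_1,\dots)=(x_1,x_2,\dots)$. A $k$-cylinder is $[x_0,\dots,x_{k-1}]=\{y\in\Sigma: y_i=x_i,\ 0\le i\le k-1\}$ for an admissible word $x_0,\dots,x_{k-1}$ (i.e. consecutive letters are allowed transitions); $\mathcal{C}_k$ is the set of $k$-cylinders. The system is topologically transitive if for all $a,b\in\mathcal{A}$ there is $N_{ab}$ (a positive integer) with $[a]\cap\sigma^{-N_{ab}}[b]\ne\emptyset$. Write $S_n\phi=\sum_{i=0}^{n-1}\phi\circ\sigma^i$. The $k$-th variation is $var_k(\phi)=\sup\{|\phi(x)-\phi(y)|: x_i=y_i,\ 0\le i\le k-1\}$; $\phi$ has summable variations if $\sum_{k\ge2}var_k(\phi)<\infty$.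 Pressure: $P(\phi)$ is the Gurevich pressure $P(\phi)=\limsup_{n\to\infty}\frac1n\log\sum_{\sigma^nx=x}e^{S_n\phi(x)}\mathbf{1}_{[a]}(x)$, which is independent of $a\in\mathcal{A}$ by transitivity. Strong positive recurrence: for $a\in\mathcal{A}$ and $x\in[a]$ let $\varphi_a(x)=\inf\{k\ge1: x_k=a\}$ and $\overline\sigma_a(x)=\sigma^{\varphi_a(x)}(x)$ be the first return map to $[a]$. For a potential $\psi$ on $\Sigma$ let $\overline\psi=\sum_{i=0}^{\varphi_a-1}\psi\circ\sigma^i$ be the induced potential on $[a]$, and let $P(\overline\psi)$ be its Gurevich pressure for the induced system $([a],\overline\sigma_a)$ (viewed as a full shift whose letters are the first return words to $a$, on points returning infinitely often). Put $$p_a^*[\phi]=\sup\{p\in\mathbb{R}: P(\overline{\phi+p})<\infty\},\qquad \Delta_a[\phi]=P(\overline{\phi+p_a^*[\phi]}),$$ with $\Delta_a[\phi]=+\infty$ if $p_a^*[\phi]=+\infty$. The system $(\Sigma,\sigma,\phi)$ is strongly positive recurrent (SPR) if $\Delta_a[\phi]>0$ for some $a\in\mathcal{A}$. Equivalently, for some $a\in\mathcal{A}$, $\limsup_{n\to\infty}\frac1n\log Z_n^*(\phi,a)<P(\phi)$, where $Z_n^*(\phi,a)=\sum_{\sigma^nx=x}e^{S_n\phi(x)}\mathbf{1}_{\{x\in[a]:\,\varphi_a(x)=n\}}(x)$. Entropy at infinity: for $n,M,q\in\mathbb{N}$ let $$B(n,M,q)=\left\{[x_0,\dots,x_n]\in\mathcal{C}_{n+1}: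 x_0,x_n\le q,\ \#\{0\le k\le n: x_k\le q\}\le\tfrac{n+1}{M}\right\},$$ $z_n(M,q)=\#B(n,M,q)$, $h_\infty(M,q)=\limsup_{n\to\infty}\frac1n\log z_n(M,q)$, $h_\infty(q)=\liminf_{M\to\infty}h_\infty(M,q)$, $h_\infty=\liminf_{q\to\infty}h_\infty(q)$. *)

(* Defs.v *)
From HB Require Import structures.
From mathcomp Require Import all_boot all_order all_algebra.
From mathcomp Require Import all_classical all_reals all_analysis.

Set Implicit Arguments.
Unset Strict Implicit.
Unset Printing Implicit Defensive.

Import Order.TTheory GRing.Theory Num.Theory.

Local Open Scope classical_set_scope.
Local Open Scope ring_scope.

(* The alphabet {1, 2, 3, ...} is coded by nat: [i : nat] stands for the letter
   i.+1, so that "letter at most q" reads [i.+1 <= q].  A 0-1 transition matrix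
   is a boolean relation.  A potential on the shift space is given by a total
   function on sequences; only its values on [shift_space M] are ever used. *)

Definition shift_space (M : rel nat) : set (nat -> nat) :=
  [set x | forall i, M (x i) (x i.+1)].

Definition shift_map (x : nat -> nat) : nat -> nat := fun i => x i.+1.

Definition cylinder (M : rel nat) (w : seq nat) : set (nat -> nat) :=
  [set x | shift_space M x /\ forall i, (i < size w)%N -> x i = nth 0%N w i].

Definition topologically_transitive (M : rel nat) : Prop :=
  forall a b : nat, exists N : nat, (0 < N)%N /\
    cylinder M [:: a] `&` iter N shift_map @^-1` cylinder M [:: b] !=set0.

Definition birkhoff_sum (R : realType) (T : Type) (f : T -> T) (phi : T -> R)
    (n : nat) (x : T) : R :=
  \sum_(i < n) phi (iter i f x).

Definition var_k (R : realType) (M : rel nat) (phi : (nat -> nat) -> R)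
    (k : nat) : \bar R :=
  ereal_sup [set z | exists x y, [/\ shift_space M x, shift_space M y,
    forall i, (i < k)%N -> x i = y i & z = `|phi x - phi y|%:E]].

Definition summable_variations (R : realType) (M : rel nat)
    (phi : (nat -> nat) -> R) : Prop :=
  (\sum_(2 <= k <oo) var_k M phi k < +oo)%E.

(* Exponential growth rate limsup_n (1/n) log u_n, with log 0 = -oo and
   log +oo = +oo.  The term n = 0 (where 0^-1 = 0) plays no role. *)
Definition growth_rate (R : realType) (u : nat -> \bar R) : \bar R :=
  limn_esup (fun n => (n%:R^-1)%:E * lne (u n))%E.

(* Gurevich pressure of the potential [phi] for the map [f], computed from the
   periodic points lying in the set [C], which is to be a 1-cylinder. *)
Definition gurevich_pressure (R : realType) (T : choiceType) (f : T -> T)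
    (C : set T) (phi : T -> R) : \bar R :=
  growth_rate (fun n =>
    \esum_(x in C `&` [set x | iter n f x = x])
      (expR (birkhoff_sum f phi n x))%:E)%E.

(* P(phi), computed with the base letter [a]; for a transitive shift and a
   potential with summable variations it does not depend on [a]. *)
Definition pressure (R : realType) (M : rel nat) (phi : (nat -> nat) -> R)
    (a : nat) : \bar R :=
  gurevich_pressure shift_map (cylinder M [:: a]) phi.

Definition chi_per (R : realType) (M : rel nat) (phi : (nat -> nat) -> R) :
    \bar R :=
  ereal_sup [set z | exists x n, [/\ shift_space M x, (0 < n)%N,
    iter n shift_map x = x & z = (n%:R^-1 * birkhoff_sum shift_map phi n x)%:E]].

(* inf {k >= 1 | x k = a}; the junk value 0 is returned when that set is empty. *)
Definition return_time (a : nat) (x : nat -> nat) : nat :=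
  if pselect (exists k, (0 < k)%N && (x k == a)) is left returns
  then ex_minn returns else 0%N.

Definition induced_map (a : nat) (x : nat -> nat) : nat -> nat :=
  iter (return_time a x) shift_map x.

Definition induced_potential (R : realType) (a : nat)
    (psi : (nat -> nat) -> R) (x : nat -> nat) : R :=
  birkhoff_sum shift_map psi (return_time a x) x.

(* The induced space: points of [a] that return to [a] infinitely often. *)
Definition induced_space (M : rel nat) (a : nat) : set (nat -> nat) :=
  cylinder M [:: a] `&` [set x | forall n, exists k, (n <= k)%N /\ x k = a].

(* First return word x_0 ... x_(r-1), where r is the return time; these words
   are the letters of the full shift coding the induced system. *)
Definition return_word (a : nat) (x : nat -> nat) : seq nat :=
  mkseq x (return_time a x).

Definition induced_alphabet (M : rel nat) (a : nat) : set (seq nat) :=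
  return_word a @` induced_space M a.

Definition induced_cylinder (M : rel nat) (a : nat) (w : seq nat) :
    set (nat -> nat) :=
  induced_space M a `&` [set x | return_word a x = w].

(* Gurevich pressure of the induced potential, computed with the base letter
   [w] of the induced full shift.  For psi = phi + p with phi of summable
   variations it does not depend on the choice of [w] in [induced_alphabet]. *)
Definition induced_pressure (R : realType) (M : rel nat)
    (psi : (nat -> nat) -> R) (a : nat) (w : seq nat) : \bar R :=
  gurevich_pressure (induced_map a) (induced_cylinder M a w)
    (induced_potential a psi).

Definition p_star (R : realType) (M : rel nat) (phi : (nat -> nat) -> R)
    (a : nat) (w : seq nat) : \bar R :=
  ereal_sup [set p%:E | p in
    [set p : R | (induced_pressure M (fun x => phi x + p)%R a w < +oo)%E]].

(* The value for p_star = -oo is a convention; this case does not occur when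
   the pressure of phi is < +oo. *)
Definition discriminant (R : realType) (M : rel nat) (phi : (nat -> nat) -> R)
    (a : nat) (w : seq nat) : \bar R :=
  match p_star M phi a w with
  | p%:E => induced_pressure M (fun x => phi x + p) a w
  | +oo%E => +oo%E
  | -oo%E => -oo%E
  end.

Definition strongly_positive_recurrent (R : realType) (M : rel nat)
    (phi : (nat -> nat) -> R) : Prop :=
  exists a w, induced_alphabet M a w /\ (0 < discriminant M phi a w)%E.

(* The set B(n, m, q) of (n+1)-cylinders. *)
Definition escaping_cylinders (R : realType) (M : rel nat) (n m q : nat) :
    set (set (nat -> nat)) :=
  [set C | exists w : seq nat,
    [/\ size w = n.+1 /\ sorted M w,
        C = cylinder M w,
        ((nth 0 w 0).+1 <= q)%N,
        ((nth 0 w n).+1 <= q)%N &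
        (count (fun i => i.+1 <= q)%N w)%:R <= n.+1%:R / m%:R :> R]].

(* z_n(m, q), which may be infinite. *)
Definition num_escaping (R : realType) (M : rel nat) (n m q : nat) : \bar R :=
  (\esum_(C in escaping_cylinders R M n m q) 1)%E.

Definition entropy_at_infinity (R : realType) (M : rel nat) : \bar R :=
  limn_einf (fun q => limn_einf (fun m =>
    growth_rate (fun n => num_escaping R M n m q))).

(* Main.v *)
Require Import Defs.
From mathcomp Require Import all_boot all_order all_algebra.
From mathcomp Require Import zify ring lra.
From mathcomp Require Import all_classical all_reals all_analysis.

(** Fix a letter [a].  A loop at [a] is an admissible cyclic word starting at [a];
loops code the periodic points of [a], and a loop [y] gets the weight
[exp (S y + p |y|)], where [S y] is the Birkhoff sum along its periodic orbit.
By bounded distortion (summable variations), inserting one loop into another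
multiplies weights up to a constant ([lsum_insert]).  Write [G p] for the sum of
all weights, and [G* p] for the sum over the first-return loops, which meet [a]
only once.  Everything is read off from these two series: [G p] converges when
[p < - P] and only when [p <= - P], and strong positive recurrence at [a] means
that [G* p] converges for some [p > - P] ([discriminant_gt0P]).  For the latter,
the induced pressure at [p] is finite exactly when [G* p] is; if it is positive
at the critical [p], then finitely many loops generate a free family of
concatenations that still makes [G] diverge slightly below [p], whereas if it is
nonpositive at some [p], then [G] converges at every smaller parameter.

Gap in the periodic averages implies recurrence.  First-return loops of length
[n] are split according to the number of visits to the letters at most [q].
Those with at most [(n + 1) / m] visits number at most [exp (n e)], because the
entropy at infinity vanishes, and each weighs at most [exp (n (chi + p))]; this
is summable for [p] slightly above [- P] since [chi < P].  The other ones visit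
some letter [b <> a] with a positive frequency.  Before any subset of these visits
one may insert a fixed loop through [a]; as the original loop meets [a] only
at its start, the insertions can be recognised, so the weights of the results,
at least [(1 + c) ^ (visits to b)] times the original weight in total, sum
up to at most [G p] ([gsum_visits_le]).  This exponential gain pays for
raising the parameter from just below to just above [- P].

Recurrence implies the gap.  Let [G* p0] converge with [p0 > - P].  A loop with
[k] visits to [a] has [p0]-weight at most [D ^ k]; and inserting before
each of its returns, or not, a different return shows that its [p]-weight
is at most [G p / (1 + c) ^ k] for [p < - P] ([weight_returns_le]).  Few
visits are thus costly by the first bound and many visits by the second, so that
eliminating [k] bounds the Birkhoff sum of every loop by a rate less than [P] times
its length, up to a constant ([loop_gap]).  An arbitrary periodic orbit is
repeated many times within a loop at [a] to get rid of the constant. *)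

Set Implicit Arguments.
Unset Strict Implicit.
Unset Printing Implicit Defensive.

Import Order.TTheory GRing.Theory Num.Theory.

Local Open Scope classical_set_scope.
Local Open Scope ring_scope.

(** * Extended sums and exponential growth rates *)

Section ExtendedSums.
Context {R : realType}.
Implicit Types T U V : choiceType.

Lemma esum_subset T (A B : set T) (f : T -> \bar R) :
  A `<=` B -> (\esum_(x in A) f x <= \esum_(x in B) f x)%E.
Proof.
move=> AB; apply: ereal_sup_le => _ [X [finX XA] <-].
by exists X => //; split=> //; exact: subset_trans AB.
Qed.

Lemma esumZl T (A : set T) (c : R) (f : T -> \bar R) :
  0 <= c -> (forall x, 0 <= f x)%E ->
  (\esum_(x in A) (c%:E * f x) = c%:E * \esum_(x in A) f x)%E.
Proof.
move=> c0 f0; rewrite /esum -ereal_supZl//; last first.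
  by apply/set0P; exists 0%E; exists set0;
    [exact: fsets_set0 | rewrite fsbig_set0].
rewrite image_comp; congr ereal_sup; apply: eq_imagel => X _ /=.
by rewrite ge0_mule_fsumr.
Qed.

Lemma esumZr T (A : set T) (c : R) (f : T -> \bar R) :
  0 <= c -> (forall x, 0 <= f x)%E ->
  (\esum_(x in A) (f x * c%:E) = (\esum_(x in A) f x) * c%:E)%E.
Proof.
by move=> c0 f0; under eq_esum do rewrite muleC; rewrite esumZl// muleC.
Qed.

(** Most estimates below compare two series of loops through an injective
surgery [e] on words, which is why injectivity is the only structural hypothesis. *)
Lemma le_esum_inj T U (A : set T) (B : set U) (e : T -> U)
    (f : T -> \bar R) (g : U -> \bar R) :
  set_inj A e -> (forall x, A x -> B (e x) /\ (f x <= g (e x))%E) ->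
  (\esum_(x in A) f x <= \esum_(y in B) g y)%E.
Proof.
move=> einj eB; apply: (@le_trans _ _ (\esum_(y in e @` A) g y)%E).
  by rewrite esum_image//; apply: le_esum => x /eB[].
by apply: esum_subset => _ [x /eB[Bx _] <-].
Qed.

Lemma le_esum_esum T U V (A : set T) (B : set U) (C : U -> set V)
    (e : T -> U * V) (f : T -> \bar R) (g : U -> V -> \bar R) :
  (forall x y, 0 <= g x y)%E -> set_inj A e ->
  (forall x, A x -> [/\ B (e x).1, C (e x).1 (e x).2
     & (f x <= g (e x).1 (e x).2)%E]) ->
  (\esum_(x in A) f x <= \esum_(y in B) \esum_(z in C y) g y z)%E.
Proof.
move=> g0 einj eBC; rewrite esum_esum//.
by apply: le_esum_inj einj _ => x /eBC[? ? ?]; split.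
Qed.

Lemma ge_esum_esum T U V (A : set T) (B : set U) (C : U -> set V)
    (e : U * V -> T) (f : T -> \bar R) (g : U -> V -> \bar R) :
  (forall x y, 0 <= g x y)%E -> set_inj (B `*`` C) e ->
  (forall y z, B y -> C y z -> A (e (y, z)) /\ (g y z <= f (e (y, z)))%E) ->
  (\esum_(y in B) \esum_(z in C y) g y z <= \esum_(x in A) f x)%E.
Proof.
move=> g0 einj eA; rewrite esum_esum//.
by apply: le_esum_inj einj _ => -[y z] [/= By Cz]; exact: eA.
Qed.

Lemma esum_fiber T (h : T -> nat) (A : set T) (f : T -> \bar R) :
  (forall x, 0 <= f x)%E ->
  (\esum_(x in A) f x =
   \esum_(k in [set: nat]) \esum_(x in A `&` [set x | h x = k]) f x)%E.
Proof.
move=> f0; rewrite -esum_bigcupT//.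
  congr esum; apply/seteqP; split=> [x Ax|x [k _ []]//].
  by exists (h x).
by move=> i j _ _ [x [[_ /= <-] [_ <-]]].
Qed.

Lemma ge_esum1 T (A : set T) (f : T -> \bar R) x :
  (0 <= f x)%E -> A x -> (f x <= \esum_(y in A) f y)%E.
Proof.
by move=> fx Ax; rewrite -[leLHS](@esum_set1 _ _ x f)//; apply: esum_subset => _ ->.
Qed.

Lemma ge_esum_seq T (A : set T) (f : T -> R) (s : seq T) :
  uniq s -> {in s, forall x, A x} ->
  ((\sum_(x <- s) f x)%:E <= \esum_(x in A) (f x)%:E)%E.
Proof.
move=> us sA; apply: esum_ge; exists [set` s].
  by split=> //; exact: finite_seq.
by rewrite -fsbig_seq// sumEFin.
Qed.

Lemma esum_gt_seq T (A : set T) (f : T -> R) (r : R) :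
  (r%:E < \esum_(x in A) (f x)%:E)%E ->
  exists s, [/\ uniq s, {in s, forall x, A x} & r < \sum_(x <- s) f x].
Proof.
move=> /ereal_sup_gt[_ [X [finX XA] <-]]; rewrite fsbig_finite//= sumEFin lte_fin.
move=> rX; exists (finmap.enum_fset (fset_set X)).
split => //.
by move=> x; rewrite in_fset_set// inE => /XA.
Qed.

Lemma esum_geometric_lty (d : R) : 0 < d ->
  (\esum_(n in [set: nat]) (expR (- d * n%:R))%:E < +oo)%E.
Proof.
move=> d0; set q := expR (- d).
have q1 : q < 1 by rewrite -expR0 ltr_expR oppr_lt0.
have q0 : 0 <= q by exact: expR_ge0.
rewrite -nneseries_esumT; last by move=> n; rewrite lee_fin expR_ge0.
apply: (@le_lt_trans _ _ ((1 - q)^-1)%:E); last exact: ltry.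
apply: lime_le; first by apply: is_cvg_nneseries => n _ _; rewrite lee_fin expR_ge0.
apply: nearW => n; rewrite sumEFin lee_fin.
under eq_bigr => i _ do rewrite mulrC expRM_natl -/q.
rewrite big_mkord -[leRHS]mul1r ler_pdivlMr ?subr_gt0// mulrC.
by rewrite -opprB mulNr -subrX1 opprB gerBl exprn_ge0.
Qed.

End ExtendedSums.

Section GrowthRates.
Context {R : realType}.
Implicit Types u : nat -> \bar R.

Lemma limn_esup_lt u (x : \bar R) :
  (limn_esup u < x)%E -> exists N, forall n, (N <= n)%N -> (u n < x)%E.
Proof.
rewrite limn_esup_lim (cvg_lim _ (@cvg_esups_inf _ _))// => /ereal_inf_lt[_ [N _ <-]] uNx.
exists N => n Nn; apply: le_lt_trans uNx.
by apply: ereal_sup_ubound; exists n.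
Qed.

Lemma limn_esup_le u (x : \bar R) N :
  (forall n, (N <= n)%N -> (u n <= x)%E) -> (limn_esup u <= x)%E.
Proof.
move=> ux; rewrite limn_esup_lim (cvg_lim _ (@cvg_esups_inf _ _))//.
apply: (@le_trans _ _ (esups u N)); first by apply: ereal_inf_lbound; exists N.
by apply: ge_ereal_sup => _ [n /= Nn <-]; exact: ux.
Qed.

Lemma limn_einf_lt u (x : \bar R) N :
  (limn_einf u < x)%E -> exists2 n, (N <= n)%N & (u n < x)%E.
Proof.
rewrite limn_einf_lim (cvg_lim _ (@cvg_einfs_sup _ _))// => ux.
have /ereal_inf_lt[_ [n /= Nn <-] unx] : (einfs u N < x)%E.
  by apply: le_lt_trans ux; apply: ereal_sup_ubound; exists N.
by exists n.
Qed.

Lemma growth_rate_lt u (r : R) : (forall n, 0 <= u n)%E ->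
  (growth_rate u < r%:E)%E ->
  exists N, forall n, (N <= n)%N -> (u n <= (expR (r * n%:R))%:E)%E.
Proof.
move=> u0 /limn_esup_lt[N uN]; exists N.+1 => n Nn.
have n0 : 0 < n%:R :> R by rewrite ltr0n (leq_trans _ Nn).
have := uN n (ltnW Nn); move: (u0 n); case: (u n) => [x|_|//].
  rewrite lee_fin => x0 /=; case: ifPn => x_gt0.
    by move=> _; rewrite lee_fin (le_trans x_gt0)// expR_ge0.
  move: x_gt0; rewrite -ltNge => x_gt0.
  rewrite -EFinM lte_fin mulrC ltr_pdivrMr// lee_fin => /ltW.
  by rewrite -ler_expR lnK.
by rewrite /= mulry gtr0_sg ?invr_gt0// mul1e.
Qed.

Lemma growth_rate_le u (r : R) N : (forall n, 0 <= u n)%E ->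
  (forall n, (N <= n)%N -> (u n <= (expR (r * n%:R))%:E)%E) ->
  (growth_rate u <= r%:E)%E.
Proof.
move=> u0 ur; apply: (@limn_esup_le _ _ N.+1) => n Nn.
have n0 : 0 < n%:R :> R by rewrite ltr0n (leq_trans _ Nn).
have := ur n (ltnW Nn); move: (u0 n); case: (u n) => [x|//|//].
rewrite !lee_fin => x0 /=; case: ifPn => x_gt0 xr.
  by rewrite mulrNy gtr0_sg ?invr_gt0// mul1e leNye.
move: x_gt0; rewrite -ltNge => x_gt0.
by rewrite -EFinM lee_fin mulrC ler_pdivrMr// -ler_expR lnK.
Qed.

(** A constant factor [K] disappears in the growth rate because it is
bounded by [exp (e n)] for large [n], for every [e > 0]. *)
Lemma growth_rate_leM u (K r : R) N : (forall n, 0 <= u n)%E ->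
  (forall n, (N <= n)%N -> (u n <= (K * expR (r * n%:R))%:E)%E) ->
  (growth_rate u <= r%:E)%E.
Proof.
move=> u0 uK; apply/lee_addgt0Pr => e e0.
have [n0 Kn0] : exists n0 : nat, K <= e * n0%:R.
  exists (Num.truncn (K / e)).+1; rewrite -ler_pdivrMl// mulrC.
  by rewrite ltW// mulrC truncnS_gt.
apply: (@growth_rate_le _ _ (maxn N n0)) => // n; rewrite geq_max => /andP[Nn n0n].
apply: (le_trans (uK n Nn)); rewrite lee_fin mulrDl expRD mulrC.
rewrite ler_pM2l ?expR_gt0//.
apply: (le_trans _ (expR_ge1Dx _)); apply: (le_trans Kn0).
by rewrite (@le_trans _ _ (e * n%:R))// ?lerDr// ler_pM2l// ler_nat.
Qed.

End GrowthRates.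

Section BoundedMultiples.
Context {R : realType}.

Lemma natmul_bounded_le0 (t K : R) : (forall j : nat, j%:R * t <= K) -> t <= 0.
Proof.
move=> tK; rewrite leNgt; apply/negP => t0.
have : K / t < (Num.truncn (K / t)).+1%:R by exact: truncnS_gt.
by rewrite ltr_pdivrMr// ltNge tK.
Qed.

Lemma expr_bounded_le1 (q K : R) : 0 < q -> (forall j : nat, q ^+ j <= K) -> q <= 1.
Proof.
move=> q0 qK; have K0 : 0 < K by rewrite (lt_le_trans _ (qK 0%N)) ?expr0.
have : ln q <= 0.
  apply: (@natmul_bounded_le0 _ (ln K)) => j.
  by rewrite mulr_natl -lnXn// ler_ln ?posrE ?exprn_gt0.
by rewrite -ler_expR lnK ?posrE// expR0.
Qed.

End BoundedMultiples.

(** * Periodic points and bounded distortion *)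

Section PeriodicPoints.
Variable M : rel nat.
Implicit Types (y u v : seq nat) (a : nat).

Lemma iter_shiftE n (x : nat -> nat) i : iter n shift_map x i = x (n + i)%N.
Proof. by elim: n x i => //= n IHn x i; rewrite /shift_map IHn addnS. Qed.

Lemma shift_space_iter n x : shift_space M x -> shift_space M (iter n shift_map x).
Proof. by move=> Mx i; rewrite !iter_shiftE addnS; exact: Mx. Qed.

Lemma birkhoff_sumD (R : realType) T (f : T -> T) (phi : T -> R) m n x :
  birkhoff_sum f phi (m + n) x =
  birkhoff_sum f phi m x + birkhoff_sum f phi n (iter m f x).
Proof.
rewrite /birkhoff_sum big_split_ord/=; congr (_ + _).
by apply: eq_bigr => i _; rewrite addnC iterD.
Qed.

Lemma birkhoff_sumDconst (R : realType) T (f : T -> T) (phi : T -> R) p n x :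
  birkhoff_sum f (fun z => phi z + p) n x = birkhoff_sum f phi n x + p * n%:R.
Proof.
by rewrite /birkhoff_sum big_split/= sumr_const card_ord mulr_natr.
Qed.

Lemma birkhoff_sum_periodic (R : realType) T (f : T -> T) (phi : T -> R) n x j :
  iter n f x = x -> birkhoff_sum f phi (j * n) x = birkhoff_sum f phi n x *+ j.
Proof.
move=> fx; elim: j => [|j IHj]; first by rewrite mul0n mulr0n /birkhoff_sum big_ord0.
by rewrite mulSn birkhoff_sumD fx IHj mulrS.
Qed.

Definition periodic_point y : nat -> nat := fun i => nth 0%N y (i %% size y).

Lemma per_nth y i : (i < size y)%N -> periodic_point y i = nth 0%N y i.
Proof. by move=> iy; rewrite /periodic_point modn_small. Qed.

Lemma per_shift y i : periodic_point y (size y + i) = periodic_point y i.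
Proof. by rewrite /periodic_point modnDl. Qed.

Lemma iter_per y : iter (size y) shift_map (periodic_point y) = periodic_point y.
Proof. by apply/funext => i; rewrite iter_shiftE per_shift. Qed.

Lemma per_mkseq n (x : nat -> nat) :
  (0 < n)%N -> iter n shift_map x = x -> periodic_point (mkseq x n) = x.
Proof.
move=> n0 xn; apply/funext => i; rewrite /periodic_point size_mkseq nth_mkseq ?ltn_mod//.
have xD j : x (n + j)%N = x j by rewrite -iter_shiftE xn.
rewrite {2}(divn_eq i n); elim: (i %/ n)%N => [|k IHk]; first by rewrite mul0n add0n.
by rewrite mulSn -addnA xD.
Qed.

Lemma mkseq_per y : mkseq (periodic_point y) (size y) = y.
Proof.
apply: (@eq_from_nth _ 0%N); rewrite size_mkseq// => i iy.
by rewrite nth_mkseq// per_nth.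
Qed.

Lemma cycleP y : (0 < size y)%N -> reflect (shift_space M (periodic_point y)) (cycle M y).
Proof.
case: y => // a s _; rewrite /cycle.
have nthE i : (i < (size s).+1)%N ->
    nth 0%N (rcons s a) i = nth 0%N (a :: s) (i.+1 %% (size s).+1).
  rewrite ltnS leq_eqVlt => /predU1P[->|ilt].
    by rewrite nth_rcons ltnn eqxx modnn.
  by rewrite nth_rcons ilt modn_small.
have nthE' i : (i < (size s).+1)%N ->
    nth 0%N (a :: rcons s a) i = nth 0%N (a :: s) i.
  by move=> ilt; rewrite -rcons_cons nth_rcons /= ilt.
apply: (iffP (pathP 0%N)) => [sM i|sM i].
  have imod : (i %% (size s).+1 < (size s).+1)%N by rewrite ltn_mod.
  have := sM (i %% (size s).+1)%N; rewrite size_rcons => /(_ imod).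
  by rewrite nthE// nthE'// -[in (_ %% _).+1]addn1 modnDml addn1.
rewrite size_rcons => ilt; rewrite nthE// nthE'//.
by have := sM i; rewrite /periodic_point/= modn_small.
Qed.

Definition loop a y := ohead y = Some a /\ cycle M y.

Lemma loop_nil a : ~ loop a [::].
Proof. by case. Qed.

Lemma loop_size a y : loop a y -> (0 < size y)%N.
Proof. by case: y => // -[]. Qed.

Lemma loopP a y : loop a y <-> exists2 s, y = a :: s & path M a (rcons s a).
Proof.
split=> [[]|[s -> sM]]; last by split.
by case: y => // b s [<-]; exists s.
Qed.

Lemma per_loop a y : loop a y -> shift_space M (periodic_point y).
Proof. by move=> ly; apply/cycleP; [exact: loop_size ly|case: ly]. Qed.

Lemma per_head a y : ohead y = Some a -> periodic_point y 0%N = a.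
Proof. by case: y => //= b s [->]. Qed.

Lemma loop_mkseq x n : (0 < n)%N -> shift_space M x -> iter n shift_map x = x ->
  loop (x 0%N) (mkseq x n).
Proof.
move=> n0 Mx xn; split; first by case: n n0 {xn}.
by apply/cycleP; rewrite ?size_mkseq// per_mkseq.
Qed.

(** Rotating the word by [size u] puts the inserted loop at a junction
between two copies of [b], where admissibility can be checked piecewise. *)
Lemma cycle_insert b u y v : loop b y -> ohead v = Some b ->
  cycle M (u ++ y ++ v) = cycle M (u ++ v).
Proof.
move=> /loopP[s -> sM]; case: v => //= _ v [->].
rewrite -(rot_cycle (size u)) rot_size_cat -[RHS](rot_cycle (size u)) rot_size_cat.
have -> : cycle M ((b :: s ++ b :: v) ++ u) =
    path M b (rcons s b ++ rcons (v ++ u) b).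
  by rewrite /= cat_rcons -catA rcons_cat.
by rewrite cat_path sM last_rcons.
Qed.

End PeriodicPoints.

Section Distortion.
Context {R : realType}.
Variables (M : rel nat) (phi : (nat -> nat) -> R).

Definition bounded_distortion (B : R) := 0 <= B /\ forall x y n,
  shift_space M x -> shift_space M y -> (forall i, (i < n.+1)%N -> x i = y i) ->
  `|birkhoff_sum shift_map phi n x - birkhoff_sum shift_map phi n y| <= B.

(** After [i < n] shifts the two points still agree on [n + 1 - i >= 2] letters,
so the errors add up to at most the sum of the variations from index 2 on.  This
is why agreement on one letter more than the length of the sum is required. *)
Lemma summable_variations_distortion :
  summable_variations M phi -> exists B, bounded_distortion B.
Proof.
rewrite /summable_variations => sv.
have [[z Mz]|M0] := pselect (exists z, shift_space M z); last first.
  by exists 0; split=> // x y n Mx; case: M0; exists x.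
have var0 k : (0 <= var_k M phi k)%E.
  by apply: ereal_sup_ubound; exists z, z; split => //; rewrite subrr normr0.
have sv0 : (0 <= \sum_(2 <= k <oo) var_k M phi k)%E by exact: nneseries_ge0.
have svE := fineK (fin_real _ : (\sum_(2 <= k <oo) var_k M phi k)%E \is a fin_num).
exists (fine (\sum_(2 <= k <oo) var_k M phi k)%E); split; first exact: fine_ge0.
move=> x y n Mx My xy; rewrite -lee_fin svE ?(lt_le_trans _ sv0)//.
apply: (@le_trans _ _ (\sum_(2 <= k < n.+2) var_k M phi k)%E); last first.
  exact: nneseries_lim_ge.
rewrite -sumrB; apply: (@le_trans _ _ (\sum_(i < n)
    `|phi (iter i shift_map x) - phi (iter i shift_map y)|)%:E).
  by rewrite lee_fin ler_norm_sum.
rewrite -sumEFin -(big_mkord xpredT (fun i =>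
  `|phi (iter i shift_map x) - phi (iter i shift_map y)|%:E)) big_nat_rev/=.
rewrite [leRHS](big_addn 0 n.+2 2) subn2 /= !big_mkord; apply: lee_sum => i _.
apply: ereal_sup_ubound; exists (iter (0 + n - i.+1) shift_map x).
exists (iter (0 + n - i.+1) shift_map y); split => //; try exact: shift_space_iter.
move=> j ji; rewrite !iter_shiftE xy//.
have := ltn_ord i; lia.
Qed.

End Distortion.

(** * Weights of loops *)

Section Weights.
Context {R : realType}.
Variables (M : rel nat) (phi : (nat -> nat) -> R) (B : R).
Hypothesis HB : bounded_distortion M phi B.
Implicit Types (y u v : seq nat) (a b : nat) (p : R).

Local Notation S := (birkhoff_sum shift_map phi).

Definition loop_sum y : R := S (size y) (periodic_point y).

Definition loop_weight p y : R := expR (loop_sum y + p * (size y)%:R).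

Local Notation lsum := loop_sum.
Local Notation weight := loop_weight.

Lemma weight_gt0 p y : 0 < weight p y. Proof. exact: expR_gt0. Qed.
Lemma weight_ge0 p y : 0 <= weight p y. Proof. exact: expR_ge0. Qed.
Lemma weighte_ge0 p y : (0 <= (weight p y)%:E)%E.
Proof. by rewrite lee_fin weight_ge0. Qed.
Hint Resolve weight_gt0 weight_ge0 weighte_ge0 : core.

(** The orbit of the long word follows the orbit of [u ++ v] along [u],
that of [y] along [y] and that of [u ++ v] again along [v].  In each of the
three stretches the agreement extends one letter further, thanks to the common
letter [b] at the junctions, so each of them costs one distortion constant. *)
Lemma lsum_insert b u y v : loop M b y -> ohead v = Some b ->
  cycle M (u ++ v) -> `|lsum (u ++ y ++ v) - lsum (u ++ v) - lsum y| <= 3 * B.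
Proof.
move=> ly hv uv; have yM := per_loop ly.
have [hy _] := ly; have y0 := loop_size ly.
have v0 : (0 < size v)%N by case: v hv {uv}.
have uvM : shift_space M (periodic_point (u ++ v)).
  by apply/cycleP; rewrite // size_cat addn_gt0 v0 orbT.
have xM : shift_space M (periodic_point (u ++ y ++ v)).
  by apply/cycleP; rewrite ?(cycle_insert _ ly)// !size_cat !addn_gt0 v0 !orbT.
have vb : nth 0%N v 0 = b by case: v hv {uv v0 uvM xM} => // ? ? [].
have yb : nth 0%N y 0 = b by case: y hy {ly yM y0 xM} => // ? ? [].
rewrite /lsum !size_cat !birkhoff_sumD.
set x := periodic_point (u ++ y ++ v) in xM *; set z := periodic_point (u ++ v) in uvM *.
have xE i : (i < size u + (size y + size v))%N -> x i = nth 0%N (u ++ y ++ v) i.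
  by move=> ilt; rewrite /x per_nth// !size_cat.
have zE i : (i < size u + size v)%N -> z i = nth 0%N (u ++ v) i.
  by move=> ilt; rewrite /z per_nth// !size_cat.
have H1 : `|S (size u) x - S (size u) z| <= B.
  apply: HB.2 => // i; rewrite ltnS leq_eqVlt => /predU1P[->|iu].
    by rewrite xE ?zE; [|lia..]; rewrite !nth_cat ltnn subnn y0 vb yb.
  by rewrite xE ?zE; [|lia..]; rewrite !nth_cat iu.
have H2 : `|S (size y) (iter (size u) shift_map x) - S (size y) (periodic_point y)| <= B.
  apply: HB.2 => //; first exact: shift_space_iter.
  move=> i; rewrite iter_shiftE ltnS leq_eqVlt => /predU1P[->|iy].
    rewrite xE; last lia.
    rewrite !nth_cat ifN; last lia.
    rewrite ifN; last lia.
    rewrite addKn subnn vb -[X in periodic_point y X]addn0 per_shift.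
    by rewrite per_nth.
  rewrite xE; last lia.
  rewrite per_nth// !nth_cat ifN; last lia.
  by rewrite addKn iy.
have H3 : `|S (size v) (iter (size y) shift_map (iter (size u) shift_map x))
           - S (size v) (iter (size u) shift_map z)| <= B.
  apply: HB.2 => //; first by do 2 apply: shift_space_iter.
    exact: shift_space_iter.
  move=> i; rewrite !iter_shiftE ltnS leq_eqVlt => /predU1P[->|iv].
    rewrite /x /z.
    have -> : (size u + (size y + size v) = size (u ++ y ++ v) + 0)%N.
      by rewrite !size_cat addn0.
    have -> : (size u + size v = size (u ++ v) + 0)%N by rewrite size_cat addn0.
    rewrite !per_shift !per_nth ?size_cat; [|lia..].
    by rewrite !nth_cat; case: ifP => // _; rewrite sub0n y0 vb yb.
  rewrite xE ?zE; [|lia..].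
  rewrite !nth_cat !ifN; [|lia..].
  by congr nth; lia.
rewrite ler_norml; move: H1 H2 H3; rewrite !ler_norml.
by move=> /andP[? ?] /andP[? ?] /andP[? ?]; apply/andP; split; lra.
Qed.

Lemma weight_insert_ge p b u y v : loop M b y -> ohead v = Some b ->
  cycle M (u ++ v) ->
  expR (- (3 * B)) * weight p y * weight p (u ++ v) <= weight p (u ++ y ++ v).
Proof.
move=> ly hv uv; have := lsum_insert ly hv uv; rewrite ler_norml => /andP[? ?].
rewrite /weight -!expRD ler_expR !size_cat !natrD; lra.
Qed.

Lemma weight_insert_le p b u y v : loop M b y -> ohead v = Some b ->
  cycle M (u ++ v) ->
  weight p (u ++ y ++ v) <= expR (3 * B) * weight p y * weight p (u ++ v).
Proof.
move=> ly hv uv; have := lsum_insert ly hv uv; rewrite ler_norml => /andP[? ?].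
rewrite /weight -!expRD ler_expR !size_cat !natrD; lra.
Qed.

Lemma loop_cat a y z : loop M a y -> loop M a z -> loop M a (y ++ z).
Proof.
move=> ly lz; split; first by case: y ly => [/loop_nil|? ? []].
have [hz cz] := lz.
by rewrite -[y ++ z]/([::] ++ y ++ z) (cycle_insert _ ly hz).
Qed.

Lemma weight_cat_ge p a y z : loop M a y -> loop M a z ->
  expR (- (3 * B)) * weight p y * weight p z <= weight p (y ++ z).
Proof. by move=> ly [hz cz]; exact: (@weight_insert_ge p a [::]). Qed.

Lemma weight_cat_le p a y z : loop M a y -> loop M a z ->
  weight p (y ++ z) <= expR (3 * B) * weight p y * weight p z.
Proof. by move=> ly [hz cz]; exact: (@weight_insert_le p a [::]). Qed.

Definition lpow j y := flatten (nseq j y).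

Lemma lpowS j y : lpow j.+1 y = y ++ lpow j y. Proof. by []. Qed.

Lemma size_lpow j y : size (lpow j y) = (j * size y)%N.
Proof. by elim: j => //= j IHj; rewrite lpowS size_cat IHj mulSn. Qed.

Lemma loop_lpow a j y : loop M a y -> loop M a (lpow j.+1 y).
Proof.
move=> ly; elim: j => [|j IHj]; first by rewrite lpowS cats0.
by rewrite lpowS; exact: loop_cat.
Qed.

Lemma per_lpow j y : (0 < size y)%N -> periodic_point (lpow j.+1 y) = periodic_point y.
Proof.
move=> y0; have n0 : (0 < size (lpow j.+1 y))%N by rewrite size_lpow mulSn; lia.
have nthE k i : (i < k * size y)%N -> nth 0%N (lpow k y) i = nth 0%N y (i %% size y).
  elim: k i => [|k IHk] i; first by rewrite mul0n.
  move=> ik; rewrite lpowS nth_cat; case: ltnP => [iy|yi].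
    by rewrite modn_small.
  rewrite IHk; last by move: ik; rewrite mulSn; lia.
  by rewrite -{2}(subnK yi) modnDr.
apply/funext => i; rewrite /periodic_point nthE -?size_lpow ?ltn_mod//.
by rewrite size_lpow modn_dvdm// dvdn_mull.
Qed.

Lemma lsum_lpow j y : (0 < size y)%N -> lsum (lpow j.+1 y) = lsum y *+ j.+1.
Proof.
by move=> y0; rewrite /lsum per_lpow// size_lpow birkhoff_sum_periodic// iter_per.
Qed.

Lemma weight_lpow p j y : (0 < size y)%N -> weight p (lpow j.+1 y) = weight p y ^+ j.+1.
Proof.
move=> y0; rewrite /weight lsum_lpow// -expRM_natl size_lpow.
by rewrite -mulr_natl natrM; congr expR; ring.
Qed.

Definition loop_series p (A : set (seq nat)) : \bar R :=
  (\esum_(y in A) (loop_weight p y)%:E)%E.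

Local Notation gsum := loop_series.

Lemma gsum_ge0 p A : (0 <= gsum p A)%E.
Proof. by apply: esum_ge0. Qed.

Lemma gsum_fin_le p A A' (K : R) (e : seq nat -> seq nat) : set_inj A e ->
  (forall y, A y -> A' (e y) /\ weight p y <= K * weight p (e y)) ->
  (gsum p A' < +oo)%E -> (gsum p A < +oo)%E.
Proof.
move=> einj eA fA'; pose K' := Num.max K 0.
apply: (@le_lt_trans _ _ (K'%:E * gsum p A')%E).
  rewrite /gsum -esumZl ?le_max ?lexx ?orbT//.
  apply: (le_esum_inj einj) => y /eA[A'y Ky]; split=> //.
  rewrite -EFinM lee_fin (le_trans Ky)// ler_pM2r//.
  by rewrite le_max lexx.
by rewrite lte_mul_pinfty// lee_fin le_max lexx orbT.
Qed.

(** Prefixing a fixed loop changes weights by at most a constant factor.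
This transfers convergence from sufficiently long loops, or loops with a prescribed
first return, to all loops. *)
Lemma gsum_prefix_fin p a u (A A' : set (seq nat)) : loop M a u ->
  A `<=` loop M a -> (forall y, A y -> A' (u ++ y)) ->
  (gsum p A' < +oo)%E -> (gsum p A < +oo)%E.
Proof.
move=> lu Aa AA'; apply: (@gsum_fin_le p A A'
    (expR (- (3 * B)) * weight p u)^-1 (cat u)).
  by move=> y z _ _ /eqP; rewrite eqseq_cat// eqxx => /eqP.
move=> y Ay; split; first exact: AA'.
rewrite ler_pdivlMl ?mulr_gt0 ?expR_gt0//.
exact: weight_cat_ge lu (Aa _ Ay).
Qed.

End Weights.

(** * The pressure as a critical exponent *)

Section Transitivity.
Variable M : rel nat.
Hypothesis Mtrans : topologically_transitive M.

Lemma transitive_walk a b : exists s, path M a (rcons s b).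
Proof.
have [N [N0 [x [[Mx xa] [_ xb]]]]] := Mtrans a b.
have {}xa : x 0%N = a by rewrite xa.
have {}xb : x N = b by rewrite -(addn0 N) -iter_shiftE xb.
exists (mkseq (fun i => x i.+1) N.-1).
have -> : rcons (mkseq (fun i => x i.+1) N.-1) b = mkseq (fun i => x i.+1) N.
  by case: N N0 xb => // N _ <-; rewrite mkseqS.
apply/(pathP 0%N) => i; rewrite size_mkseq => iN.
rewrite nth_mkseq//; case: i iN => [|i] iN /=; first by rewrite -xa.
by rewrite nth_mkseq// ltnW.
Qed.

Lemma transitive_loop a b : exists u v, loop M a (a :: u ++ b :: v).
Proof.
have [u au] := transitive_walk a b; have [v bv] := transitive_walk b a.
exists u, v; apply/loopP; exists (u ++ b :: v) => //.
by rewrite rcons_cat/= -cat_rcons cat_path au last_rcons.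
Qed.

End Transitivity.

Lemma lte_EFin_dense (R : realType) (x : \bar R) (r : R) :
  (x < r%:E)%E -> exists2 s : R, s < r & (x < s%:E)%E.
Proof.
case: x => [x|//|_]; last by exists (r - 1); rewrite ?ltNyr//; lra.
by rewrite lte_fin => xr; exists ((x + r) / 2); rewrite ?lte_fin; lra.
Qed.

Section Pressure.
Context {R : realType}.
Variables (M : rel nat) (phi : (nat -> nat) -> R) (B : R).
Hypothesis HB : bounded_distortion M phi B.
Implicit Types (y u v : seq nat) (a b : nat) (p r : R).

Local Notation lsum := (loop_sum phi).
Local Notation weight := (loop_weight phi).
Local Notation gsum := (loop_series phi).

Lemma periodic_esum a n p : (0 < n)%N ->
  (gsum p (loop M a `&` [set y | size y = n]) =
   (\esum_(x in cylinder M [:: a] `&` [set x | iter n shift_map x = x])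
     (expR (birkhoff_sum shift_map phi n x))%:E) * (expR (p * n%:R))%:E)%E.
Proof.
move=> n0; rewrite -esumZr; [|exact: expR_ge0|by move=> x; rewrite lee_fin expR_ge0].
rewrite (@reindex_esum _ _ _ (loop M a `&` [set y | size y = n]) _ periodic_point).
  by apply: eq_esum => y [_ /= yn]; rewrite -EFinM -expRD /loop_weight /loop_sum yn.
split.
- move=> y [/= ly <-]; split; last exact: iter_per.
  split; first exact: per_loop ly.
  by case=> // _; case: ly => /per_head.
- move=> y z; rewrite !inE => -[_ /= yn] [_ /= zn] yz.
  by rewrite -(mkseq_per y) -(mkseq_per z) yz yn zn.
- move=> x [[Mx xa] xn]; exists (mkseq x n); last exact: per_mkseq.
  split; last by rewrite /= size_mkseq.
  by have <- : x 0%N = a by [exact: xa]; exact: loop_mkseq.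
Qed.

Lemma gsum_subset p A A' : A `<=` A' -> (gsum p A <= gsum p A')%E.
Proof. exact: esum_subset. Qed.

(** The root test gives convergence over long loops only; the finitely many
remaining lengths, whose sums might be infinite a priori, are reached by
prefixing. *)
Lemma gsum_lty_of_pressure a r : (pressure M phi a < r%:E)%E ->
  (gsum (- r) (loop M a) < +oo)%E.
Proof.
move=> /lte_EFin_dense[s sr /growth_rate_lt[|N uN]].
  by move=> n; apply: esum_ge0 => x _; rewrite lee_fin expR_ge0.
have [[g lg]|Nl] := pselect (exists g, loop M a g); last first.
  rewrite (_ : loop M a = set0) /loop_series ?esum_set0//.
  by apply/seteqP; split=> // y ly; apply: Nl; exists y.
apply: (@gsum_prefix_fin _ _ _ _ HB _ a (lpow N.+1 g) _
  (loop M a `&` [set y | (N < size y)%N])) => //.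
- exact: loop_lpow.
- move=> y ly; split; first by apply: loop_cat ly; exact: loop_lpow.
  rewrite /= size_cat size_lpow; apply: leq_trans (leq_addr _ _).
  by apply: leq_pmulr; exact: loop_size lg.
rewrite /loop_series (@esum_fiber _ _ size)//; last by move=> y; exact: weighte_ge0.
have sr0 : 0 < r - s by rewrite subr_gt0.
apply: le_lt_trans (esum_geometric_lty sr0); apply: le_esum => n _.
have [nN|Nn] := leqP n N.
  rewrite esum1 ?lee_fin ?expR_ge0// => y [[_ /= + yn]]; rewrite yn; lia.
apply: (@le_trans _ _ (gsum (- r) (loop M a `&` [set y | size y = n]))).
  by apply: gsum_subset => y [[]].
rewrite periodic_esum ?(leq_trans _ Nn)//.
apply: le_trans (lee_wpmul2r _ (uN n (ltnW Nn))) _; first by rewrite lee_fin expR_ge0.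
by rewrite -EFinM -expRD lee_fin ler_expR; lra.
Qed.

Lemma pressure_le_of_gsum a p : (gsum p (loop M a) < +oo)%E ->
  (pressure M phi a <= (- p)%:E)%E.
Proof.
move=> Gfin; have Gr : gsum p (loop M a) \is a fin_num.
  by rewrite ge0_fin_numE// gsum_ge0.
apply: (@growth_rate_leM _ _ (fine (gsum p (loop M a))) _ 1%N).
  by move=> n; apply: esum_ge0 => x _; rewrite lee_fin expR_ge0.
move=> n n0; rewrite EFinM fineK//.
have := gsum_subset p (@subIsetl _ (loop M a) [set y | size y = n]).
rewrite periodic_esum// => H.
have e0 : (0 <= (expR (- p * n%:R))%:E :> \bar R)%E by rewrite lee_fin expR_ge0.
have := lee_wpmul2r e0 H; rewrite -muleA -EFinM -expRD mulNr subrr expR0.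
by rewrite mule1.
Qed.

Hypothesis Mtrans : topologically_transitive M.

(** A loop at [b] is inserted into a fixed loop at [a] through [b]. *)
Lemma gsum_base a b p : (gsum p (loop M a) < +oo)%E -> (gsum p (loop M b) < +oo)%E.
Proof.
have [u [v luv]] := transitive_loop Mtrans a b.
have [_ cuv] := luv.
apply: (@gsum_fin_le _ _ _ _ _ (expR (- (3 * B)) * weight p (a :: u ++ b :: v))^-1
  (fun y => (a :: u) ++ y ++ b :: v)).
  move=> y z _ _ /eqP; rewrite eqseq_cat// eqxx/= => /eqP yz.
  have yzn : size y = size z by have /(congr1 size) := yz; rewrite !size_cat => /addIn.
  by move/eqP: yz; rewrite eqseq_cat// => /andP[/eqP].
move=> y ly; split; first by split=> //; rewrite (cycle_insert _ ly).
rewrite ler_pdivlMl ?mulr_gt0 ?expR_gt0//.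
rewrite mulrAC; exact: (@weight_insert_ge _ _ _ _ HB p b (a :: u) y (b :: v)).
Qed.

End Pressure.

(** * Return loops and the induced system *)

Section ReturnLoops.
Variables (M : rel nat) (a : nat).
Implicit Types (y z u v w : seq nat) (L : seq (seq nat)).

(** For [k = 1] these are the first-return loops, that is the letters of the
full shift that codes the induced system; in general they code the periodic
points of period [k] of the induced map. *)
Definition rloop k : set (seq nat) := [set y | loop M a y /\ count_mem a y = k].

Lemma rloop_loop k : rloop k `<=` loop M a. Proof. by move=> y []. Qed.

Lemma rloop1P y : rloop 1 y <-> exists s,
  [/\ y = a :: s, path M a (rcons s a) & a \notin s].
Proof.
split=> [[/loopP[s -> sM]]|[s [-> sM sa]]].
  rewrite /= eqxx add1n => -[c0]; exists s; split=> //.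
  by rewrite -has_pred1 has_count c0.
split; first by apply/loopP; exists s.
by rewrite /= eqxx (count_memPn sa).
Qed.

Lemma loop_count y : loop M a y -> (0 < count_mem a y)%N.
Proof. by move=> /loopP[s -> _]; rewrite /= eqxx. Qed.

Lemma rloop_cat j k y z : rloop j y -> rloop k z -> rloop (j + k) (y ++ z).
Proof. by move=> [ly <-] [lz <-]; split; [exact: loop_cat | rewrite count_cat]. Qed.

Lemma loop_catE s1 s2 :
  loop M a (a :: s1 ++ a :: s2) <-> loop M a (a :: s1) /\ loop M a (a :: s2).
Proof.
have pE : path M a (rcons (s1 ++ a :: s2) a) =
    path M a (rcons s1 a) && path M a (rcons s2 a).
  by rewrite rcons_cat /= -cat_rcons cat_path last_rcons.
split=> [[_]|[[_ /= p1] [_ /= p2]]]; last by split=> //; rewrite /= pE p1.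
by rewrite /= pE => /andP[].
Qed.

Definition first_return y := take (index a (behead y)).+1 y.

Lemma first_return_cat u v : rloop 1 u -> v = [::] \/ ohead v = Some a ->
  first_return (u ++ v) = u.
Proof.
move=> /rloop1P[s [-> _ sa]] hv; rewrite /first_return /= index_cat (negPf sa).
have -> : index a v = 0%N by case: v hv => [//|x v [//|[->]]] /=; rewrite eqxx.
by rewrite addn0 take_size_cat.
Qed.

Lemma rloop_split k y : rloop k.+2 y ->
  exists u v, [/\ rloop 1 u, rloop k.+1 v & y = u ++ v].
Proof.
move=> [/loopP[s yE sM]]; rewrite yE /= eqxx add1n => -[cs].
have sa : has (pred1 a) s by rewrite has_count cs.
case: (split_find_nth 0%N sa) yE sM cs => x s1 s2 /eqP -> s1a yE sM cs.
rewrite has_pred1 in s1a; move: sM yE cs; rewrite cat_rcons => sM yE cs.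
have [l1 l2] : loop M a (a :: s1) /\ loop M a (a :: s2).
  by apply/loop_catE; apply/loopP; exists (s1 ++ a :: s2).
exists (a :: s1), (a :: s2); split=> //.
  by split=> //; rewrite /= eqxx (count_memPn s1a).
by split=> //; move: cs; rewrite count_cat (count_memPn s1a) /= eqxx.
Qed.

Lemma rloop_flatten L : (forall u, u \in L -> rloop 1 u) ->
  flatten L = [::] \/ ohead (flatten L) = Some a.
Proof.
case: L => [|u L] rL; [by left|right => /=].
by have /rloop1P[s [-> _ _]] := rL u (mem_head _ _).
Qed.

(** First-return loops form a code: the first one extends up to the second
occurrence of [a]. *)
Lemma flatten_rloop_inj L L' : (forall u, u \in L -> rloop 1 u) ->
  (forall u, u \in L' -> rloop 1 u) -> flatten L = flatten L' -> L = L'.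
Proof.
have rL0 u L0 : (forall u0, u0 \in u :: L0 -> rloop 1 u0) ->
    rloop 1 u /\ (forall u0, u0 \in L0 -> rloop 1 u0).
  by move=> H; split=> [|v vL]; apply: H; rewrite ?mem_head// inE vL orbT.
elim: L L' => [|u L IHL] [|u' L'] rL rL' //=.
- by have /rloop1P[s [-> _ _]] := rL' u' (mem_head _ _).
- by have /rloop1P[s [-> _ _]] := rL u (mem_head _ _).
have [ru {}rL] := rL0 _ _ rL; have [ru' {}rL'] := rL0 _ _ rL'.
move=> LL'; have uu' : u = u'.
  rewrite -(first_return_cat ru (rloop_flatten rL)) LL'.
  by rewrite (first_return_cat ru' (rloop_flatten rL')).
move: LL'; rewrite uu' => /eqP; rewrite eqseq_cat// eqxx => /eqP LL'.
by rewrite (IHL L').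
Qed.

Lemma rloop_decompose k y : rloop k.+1 y ->
  exists L, [/\ forall u, u \in L -> rloop 1 u, flatten L = y & size L = k.+1].
Proof.
elim: k y => [|k IHk] y ry.
  by exists [:: y]; split=> [u|/=|//]; rewrite ?cats0// inE => /eqP->.
have [u [v [ru /IHk[L [rL <- sL]] ->]]] := rloop_split ry.
exists (u :: L); split=> //=; last by rewrite sL.
by move=> z; rewrite inE => /predU1P[->//|]; exact: rL.
Qed.

Lemma loop_of_flatten L : L != [::] -> (forall u, u \in L -> rloop 1 u) ->
  loop M a (flatten L).
Proof.
elim: L => // u [|v L] IHL _ rL /=.
  by rewrite cats0; case: (rL u (mem_head _ _)).
apply: loop_cat; first by case: (rL u (mem_head _ _)).
by apply: IHL => // w wL; apply: rL; rewrite inE wL orbT.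
Qed.

End ReturnLoops.

Section InducedSystem.
Context {R : realType}.
Variables (M : rel nat) (phi : (nat -> nat) -> R) (a : nat).
Implicit Types (y z u v w : seq nat).

Local Notation rt := (return_time a).

Lemma return_timeE (x : nat -> nat) r : (0 < r)%N -> x r = a ->
  (forall j, (0 < j < r)%N -> x j <> a) -> rt x = r.
Proof.
move=> r0 xr xj; rewrite /return_time; case: pselect => [ex|[]]; last first.
  by exists r; rewrite r0 xr eqxx.
case: ex_minnP => m /andP[m0 /eqP xm] mle.
have mr : (m <= r)%N by apply: mle; rewrite r0 xr eqxx.
apply/eqP; rewrite eqn_leq mr /= leqNgt; apply/negP => mr'.
by apply: (xj m) => //; rewrite m0.
Qed.

Lemma return_timeP (x : nat -> nat) : induced_space M a x ->
  [/\ (0 < rt x)%N, x (rt x) = a & forall j, (0 < j < rt x)%N -> x j <> a].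
Proof.
move=> [_ xinf]; rewrite /return_time; case: pselect => [ex|[]]; last first.
  by have [k [k0 xk]] := xinf 1%N; exists k; rewrite k0 xk eqxx.
case: ex_minnP => m /andP[m0 /eqP xm] mle; split=> // j /andP[j0 jm] xj.
by have := mle j; rewrite j0 xj eqxx => /(_ isT); rewrite leqNgt jm.
Qed.

Lemma induced_space0 x : induced_space M a x -> x 0%N = a.
Proof. by move=> [[_ x0] _]; exact: x0. Qed.

Lemma induced_space_shift (x : nat -> nat) n : induced_space M a x -> x n = a ->
  induced_space M a (iter n shift_map x).
Proof.
move=> [[Mx _] xinf] xn; split.
  by split=> [|[]//=]; [exact: shift_space_iter | rewrite iter_shiftE addn0].
move=> m; have [k [mk xk]] := xinf (m + n)%N; exists (k - n)%N; split; first lia.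
by rewrite iter_shiftE subnKC//; lia.
Qed.

Definition return_sum k x := \sum_(i < k) rt (iter i (induced_map a) x).

Lemma return_sumS k x :
  return_sum k.+1 x = (return_sum k x + rt (iter k (induced_map a) x))%N.
Proof. by rewrite /return_sum big_ord_recr. Qed.

Lemma iter_induced k x :
  iter k (induced_map a) x = iter (return_sum k x) shift_map x.
Proof.
elim: k => [|k IHk]; first by rewrite /return_sum big_ord0.
by rewrite return_sumS addnC iterD -IHk.
Qed.

Lemma birkhoff_sum_induced (psi : (nat -> nat) -> R) k x :
  birkhoff_sum (induced_map a) (induced_potential a psi) k x =
  birkhoff_sum shift_map psi (return_sum k x) x.
Proof.
elim: k => [|k IHk]; first by rewrite /return_sum /birkhoff_sum !big_ord0.
rewrite return_sumS birkhoff_sumD -IHk -iter_induced.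
by rewrite /birkhoff_sum big_ord_recr.
Qed.

Lemma count_mkseq_return (x : nat -> nat) : induced_space M a x ->
  count_mem a (mkseq x (rt x)) = 1%N.
Proof.
move=> xa; have [r0 xr xj] := return_timeP xa; have x0 := induced_space0 xa.
case: (rt x) r0 xj => // r _ xj; rewrite /mkseq /= x0 eqxx.
rewrite (count_memPn _)//; apply/negP => /mapP[j]; rewrite mem_iota => jr /esym.
by apply: xj; lia.
Qed.

Lemma return_sumP k x : induced_space M a x ->
  [/\ x (return_sum k x) = a, count_mem a (mkseq x (return_sum k x)) = k
    & induced_space M a (iter k (induced_map a) x)].
Proof.
move=> xa; elim: k => [|k [xk ck ik]].
  by rewrite /return_sum big_ord0; split=> //; exact: induced_space0.
have [r0 xr xj] := return_timeP ik.
have xS : x (return_sum k.+1 x) = a by rewrite return_sumS -iter_shiftE -iter_induced.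
split=> //; last by rewrite iter_induced; exact: induced_space_shift.
rewrite return_sumS /mkseq iotaD map_cat count_cat ck add0n.
rewrite -[X in iota X _]addn0 iotaDl -map_comp -addn1; congr addn.
rewrite -(count_mkseq_return ik) /mkseq iter_induced; congr count; apply: eq_map => i /=.
by rewrite iter_shiftE.
Qed.

(** The number of visits to [a] grows strictly from one visit to the next,
so it determines the time of the visit. *)
Lemma return_sum_unique k (x : nat -> nat) n : induced_space M a x -> x n = a ->
  count_mem a (mkseq x n) = k -> return_sum k x = n.
Proof.
move=> xa xn xk; have [xN cN _] := return_sumP k xa.
have lt_count i j : (i < j)%N -> x i = a ->
    (count_mem a (mkseq x i) < count_mem a (mkseq x j))%N.
  move=> ij xi; rewrite -(subnKC ij) /mkseq iotaD map_cat count_cat.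
  rewrite -[in iota 0 i.+1](addn1 i) iotaD map_cat count_cat /= xi eqxx; lia.
have [lt|lt|//] := ltngtP (return_sum k x) n.
  by have := lt_count _ _ lt xN; rewrite cN xk ltnn.
by have := lt_count _ _ lt xn; rewrite cN xk ltnn.
Qed.

Lemma per_induced_space y : loop M a y -> induced_space M a (periodic_point y).
Proof.
move=> ly; split; first split; first exact: per_loop ly.
  by case=> // _; case: ly => /per_head.
have y0 := loop_size ly.
move=> n; exists (n * size y)%N; split; first exact: leq_pmulr.
rewrite /periodic_point modnMl; have [hy _] := ly.
by rewrite -[LHS](per_nth y0); exact: per_head.
Qed.

Lemma return_word_per u v : rloop M a 1 u -> v = [::] \/ ohead v = Some a ->
  return_word a (periodic_point (u ++ v)) = u.
Proof.
move=> /rloop1P[s [uE _ sa]] hv; rewrite /return_word.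
have xu i : (i < size u)%N -> periodic_point (u ++ v) i = nth 0%N u i.
  by move=> iu; rewrite per_nth ?nth_cat ?iu// size_cat ltn_addr.
rewrite (@return_timeE _ (size u)).
- apply: (@eq_from_nth _ 0%N); rewrite size_mkseq// => i iu.
  by rewrite nth_mkseq// xu.
- by rewrite uE.
- case: hv => [->|].
    rewrite cats0 -[X in periodic_point _ X]addn0 per_shift; apply: per_head.
    by rewrite uE.
  case: v xu => // b v xu [ba].
  by rewrite per_nth ?nth_cat ?ltnn ?subnn// size_cat /= addnS ltnS leq_addr.
- move=> j /andP[j0 ju]; rewrite xu// uE; case: j j0 ju => // j _ ju /= sj.
  by move: sa; rewrite -sj mem_nth//; move: ju; rewrite uE.
Qed.

Lemma induced_alphabetE w : induced_alphabet M a w <-> rloop M a 1 w.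
Proof.
split=> [[x xa <-]|rw]; last first.
  exists (periodic_point w); first exact: per_induced_space (rloop_loop rw).
  by rewrite -[X in periodic_point X]cats0; apply: return_word_per => //; left.
split; last exact: count_mkseq_return.
have [r0 xr _] := return_timeP xa; have x0 := induced_space0 xa.
rewrite /return_word; case: (rt x) r0 xr => // r _ xr.
apply/loopP; exists (mkseq (fun i => x i.+1) r).
  by rewrite /mkseq /= x0; congr cons; rewrite (iotaDl 1) -map_comp.
rewrite -xr -[rcons _ _](mkseqS (fun i => x i.+1)).
apply/(pathP 0%N) => i; rewrite size_mkseq => ir; rewrite nth_mkseq//.
have [[Mx _] _] := xa.
case: i ir => [|i] ir /=; first by rewrite xr -x0.
by rewrite nth_mkseq// ltnW.
Qed.

(** Periodic points of the induced map are periodic points of the shift; the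
period counted in returns becomes the number of visits to [a] of the loop. *)
Lemma induced_periodic_esum p k w : (0 < k)%N ->
  (\esum_(x in induced_cylinder M a w `&` [set x | iter k (induced_map a) x = x])
    (expR (birkhoff_sum (induced_map a)
       (induced_potential a (fun x => phi x + p)) k x))%:E =
  loop_series phi p (rloop M a k `&` [set y | return_word a (periodic_point y) = w]))%E.
Proof.
move=> k0; rewrite (@reindex_esum _ _ _
    (rloop M a k `&` [set y | return_word a (periodic_point y) = w]) _ periodic_point).
  apply: eq_esum => y [[ly cy] _]; congr (_%:E).
  rewrite birkhoff_sum_induced (@return_sum_unique _ _ (size y)).
  - by rewrite birkhoff_sumDconst.
  - exact: per_induced_space.
  - by rewrite -[X in periodic_point _ X]addn0 per_shift; case: ly => /per_head.
  - by rewrite mkseq_per.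
have rsE y : rloop M a k y -> return_sum k (periodic_point y) = size y.
  move=> [ly cy]; apply: return_sum_unique; rewrite ?mkseq_per//.
    exact: per_induced_space.
  by rewrite -[X in periodic_point _ X]addn0 per_shift; case: ly => /per_head.
split.
- move=> y [ry yw]; split; first split=> //.
    exact: per_induced_space (rloop_loop ry).
  by rewrite /= iter_induced rsE// iter_per.
- move=> y z; rewrite !inE => -[ry _] [rz _] yz.
  by rewrite -(mkseq_per y) -(mkseq_per z) yz -(rsE _ ry) -(rsE _ rz) yz.
- move=> x [[xa xw] /= xk]; have [xN cN _] := return_sumP k xa.
  rewrite iter_induced in xk.
  have N0 : (0 < return_sum k x)%N.
    by case: (return_sum k x) cN => // k0'; move: k0; rewrite -k0'.
  have [[Mx _] _] := xa.
  exists (mkseq x (return_sum k x)); last exact: per_mkseq.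
  split; last by rewrite /= per_mkseq.
  by split=> //; rewrite -(induced_space0 xa); exact: loop_mkseq.
Qed.

End InducedSystem.

(** * The discriminant and the series of first-return loops *)

Section Discriminant.
Context {R : realType}.
Variables (M : rel nat) (phi : (nat -> nat) -> R) (B : R) (a : nat).
Hypothesis HB : bounded_distortion M phi B.
Implicit Types (y u v w : seq nat) (p : R).

Local Notation weight := (loop_weight phi).
Local Notation gsum := (loop_series phi).
Local Notation rloop := (rloop M a).

Lemma rloop_cat_inj k y y' z z' : rloop k.+1 y -> rloop k.+1 y' ->
  loop M a z -> loop M a z' -> y ++ z = y' ++ z' -> y = y' /\ z = z'.
Proof.
move=> ry ry' lz lz' yz.
have loopr x : loop M a x -> exists2 L, (forall u, u \in L -> rloop 1 u) & flatten L = x.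
  move=> lx; have := loop_count lx; case E : (count_mem a x) => [//|j] _.
  have [L [rL <- _]] := @rloop_decompose M a j x (conj lx E).
  by exists L.
have [L [rL yE sL]] := rloop_decompose ry.
have [L' [rL' yE' sL']] := rloop_decompose ry'.
have [[K rK zE] [K' rK' zE']] := (loopr _ lz, loopr _ lz').
have/eqP : L ++ K = L' ++ K'.
  apply: (@flatten_rloop_inj M a).
  - by move=> u; rewrite mem_cat => /orP[/rL|/rK].
  - by move=> u; rewrite mem_cat => /orP[/rL'|/rK'].
  - by rewrite !flatten_cat yE zE yE' zE'.
rewrite eqseq_cat ?sL ?sL'// => /andP[/eqP LL' /eqP KK'].
by rewrite -yE -yE' LL' -zE -zE' KK'.
Qed.

(** Splitting off the first return, up to the distortion of one insertion. *)
Lemma gsum_rloopS p k :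
  (gsum p (rloop k.+2) <= (expR (3 * B))%:E *
     \esum_(u in rloop 1) ((weight p u)%:E * gsum p (rloop k.+1)))%E.
Proof.
rewrite -esumZl ?expR_ge0//; last first.
  by move=> u; rewrite mule_ge0 ?gsum_ge0 ?weighte_ge0.
pose split2 y := (first_return a y, drop (size (first_return a y)) y).
have splitE y : rloop k.+2 y ->
    exists u v, [/\ rloop 1 u, rloop k.+1 v, y = u ++ v & split2 y = (u, v)].
  move=> /rloop_split[u [v [ru rv ->]]]; exists u, v; split=> //.
  have hv : ohead v = Some a by case: rv => -[].
  by rewrite /split2 (first_return_cat ru (or_intror hv)) drop_size_cat.
have -> : (\esum_(u in rloop 1)
    ((expR (3 * B))%:E * ((weight p u)%:E * gsum p (rloop k.+1))) =
  \esum_(u in rloop 1) \esum_(v in rloop k.+1)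
    (expR (3 * B) * weight p u * weight p v)%:E)%E.
  apply: eq_esum => u _; rewrite muleA -EFinM /loop_series -esumZl.
  - by apply: eq_esum => v _; rewrite EFinM.
  - by rewrite mulr_ge0 ?expR_ge0.
  - by move=> v; exact: weighte_ge0.
apply: (@le_esum_esum _ _ _ _ _ _ (fun=> rloop k.+1) split2).
- by move=> u v; rewrite lee_fin !mulr_ge0 ?expR_ge0.
- move=> y z; rewrite !inE => /splitE[u [v [_ _ -> ->]]] /splitE[u' [v' [_ _ -> ->]]].
  by case=> -> ->.
- move=> y /splitE[u [v [ru rv -> ->]]]; split=> //=.
  by rewrite lee_fin (weight_cat_le HB p (rloop_loop ru) (rloop_loop rv)).
Qed.

Lemma gsum_rloop_le p : (gsum p (rloop 1) < +oo)%E ->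
  exists2 D : R, 1 <= D & forall k, (gsum p (rloop k.+1) <= (D ^+ k.+1)%:E)%E.
Proof.
move=> Gfin; have Gr : gsum p (rloop 1) \is a fin_num by rewrite ge0_fin_numE// gsum_ge0.
set G := fine (gsum p (rloop 1)); have G0 : 0 <= G by rewrite fine_ge0// gsum_ge0.
have B3 : 1 <= expR (3 * B) by rewrite -[leLHS]expR0 ler_expR; have [B0 _] := HB; lra.
exists (expR (3 * B) * (G + 1)); first nra.
elim=> [|k IHk].
  by rewrite -[leLHS]fineK// lee_fin expr1 -/G; nra.
apply: (le_trans (gsum_rloopS p k)); set D := _ * (G + 1) in IHk *.
have D0 : 0 <= D by rewrite /D; nra.
apply: (@le_trans _ _ ((expR (3 * B))%:E *
  \esum_(u in rloop 1) ((weight p u)%:E * (D ^+ k.+1)%:E))%E).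
  apply: lee_wpmul2l; first by rewrite lee_fin expR_ge0.
  by apply: le_esum => u _; apply: lee_wpmul2l => //; exact: weighte_ge0.
rewrite esumZr ?exprn_ge0//; last by move=> u; exact: weighte_ge0.
rewrite -/(gsum p (rloop 1)) -[X in (_ * (X * _))%E]fineK// -/G -!EFinM lee_fin.
rewrite mulrA [leRHS]exprS ler_wpM2r ?exprn_ge0//.
by rewrite /D ler_pM2l ?expR_gt0// lerDl.
Qed.

(** By unique decoding, the [j]-fold concatenations of the loops of [s]
weigh at least [q ^ j] in total, where [q > 1] is their joint weight divided by the
distortion constant of one concatenation. *)
Lemma gsum_loop_diverges p k (s : seq (seq nat)) :
  uniq s -> {in s, forall y, rloop k.+1 y} ->
  expR (3 * B) < \sum_(y <- s) weight p y -> ~ (gsum p (loop M a) < +oo)%E.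
Proof.
move=> us rs; set W := \sum_(y <- s) _ => WB.
pose q := expR (- (3 * B)) * W.
have q1 : 1 < q by rewrite /q expRN mulrC ltr_pdivlMr ?expR_gt0// mul1r.
have X j : ((q ^+ j)%:E <= gsum p (rloop (j.+1 * k.+1)))%E.
  elim: j => [|j IHj].
    rewrite mul1n expr0; apply: le_trans (_ : (W%:E <= _)%E); last exact: ge_esum_seq.
    rewrite lee_fin.
    by rewrite (le_trans _ (ltW WB))// -[leLHS]expR0 ler_expR; have [B0 _] := HB; lra.
  apply: (@le_trans _ _ (\esum_(y in [set` s]) \esum_(z in rloop (j.+1 * k.+1))
      (expR (- (3 * B)) * weight p y * weight p z)%:E)%E).
    apply: (@le_trans _ _ (\esum_(y in [set` s])
        (expR (- (3 * B)) * q ^+ j * weight p y)%:E)%E).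
      apply: le_trans (@ge_esum_seq _ _ [set` s] _ s us _); last by move=> y.
      by rewrite -mulr_sumr lee_fin -/W exprS /q; lra.
    apply: le_esum => y _; rewrite mulrAC EFinM.
    apply: le_trans (lee_wpmul2l _ IHj) _; first by rewrite lee_fin mulr_ge0 ?expR_ge0.
    rewrite /loop_series -esumZl ?mulr_ge0 ?expR_ge0//; last by move=> z; exact: weighte_ge0.
  apply: (@ge_esum_esum _ _ _ _ _ _ (fun=> rloop (j.+1 * k.+1))
     (fun yz => yz.1 ++ yz.2)).
  - by move=> y z; rewrite lee_fin !mulr_ge0 ?expR_ge0.
  - move=> [y z] [y' z']; rewrite !inE => -[/= /rs ry [lz _]] [/= /rs ry' [lz' _]].
    by case/(rloop_cat_inj ry ry' lz lz') => -> ->.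
  - move=> y z /rs ry rz /=; split; first by rewrite mulSn; exact: rloop_cat.
    by rewrite lee_fin (weight_cat_ge HB p (rloop_loop ry) (rloop_loop rz)).
move=> Gfin; have Gr : gsum p (loop M a) \is a fin_num by rewrite ge0_fin_numE// gsum_ge0.
have Xj j : q ^+ j <= fine (gsum p (loop M a)).
  rewrite -lee_fin fineK//; apply: le_trans (X j) _.
  by apply: esum_subset; exact: rloop_loop.
by have := expr_bounded_le1 (lt_trans ltr01 q1) Xj; rewrite leNgt q1.
Qed.

Lemma induced_sum_ge0 p w k :
  (0 <= \esum_(x in induced_cylinder M a w `&` [set x | iter k (induced_map a) x = x])
    (expR (birkhoff_sum (induced_map a)
       (induced_potential a (fun x => (phi x + p)%R)) k x))%:E)%E.
Proof. by apply: esum_ge0 => x _; rewrite lee_fin expR_ge0. Qed.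

Lemma induced_pressure_lty p w : (gsum p (rloop 1) < +oo)%E ->
  (induced_pressure M (fun x => (phi x + p)%R) a w < +oo)%E.
Proof.
move=> /gsum_rloop_le[D D1 GD].
apply: (@le_lt_trans _ _ (ln D)%:E); last exact: ltry.
apply: (@growth_rate_le _ _ _ 1%N); first exact: induced_sum_ge0.
case=> // k _; rewrite induced_periodic_esum// expRM_natr lnK ?posrE ?(lt_le_trans _ D1)//.
apply: le_trans (GD k); apply: esum_subset; exact: subIsetl.
Qed.

(** Already a single, large enough number of returns suffices: prefixing
[w] sufficiently often turns every first-return loop into a loop counted by the
induced pressure. *)
Lemma gsum_first_return_lty p w : rloop 1 w ->
  (induced_pressure M (fun x => (phi x + p)%R) a w < +oo)%E ->
  (gsum p (rloop 1) < +oo)%E.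
Proof.
move=> rw Pfin.
have [r Pr] : exists r : R, (induced_pressure M (fun x => (phi x + p)%R) a w < r%:E)%E.
  move: Pfin; case: induced_pressure => [x _|//|_]; last by exists 0; rewrite ltNyr.
  by exists (x + 1); rewrite lte_fin; lra.
have [N uN] := growth_rate_lt (induced_sum_ge0 p w) Pr.
apply: (@gsum_prefix_fin _ _ _ _ HB _ a (lpow N.+1 w) _
  (rloop N.+2 `&` [set y | return_word a (periodic_point y) = w])).
- by apply: loop_lpow; exact: rloop_loop rw.
- exact: rloop_loop.
- move=> y ry.
  have rpow n : rloop n.+1 (lpow n w ++ y).
    by elim: n => // n IHn; rewrite lpowS -catA -add1n; exact: rloop_cat.
  split; first exact: rpow.
  rewrite /= lpowS -catA; apply: (return_word_per (M := M)) => //; right.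
  by case: (rpow N) => -[].
- rewrite -induced_periodic_esum//; apply: le_lt_trans (uN _ _) _; last exact: ltry.
  by rewrite ltnW// ltnW.
Qed.

(** Loops are at least as long as their number of visits, so lowering the
parameter wins an exponential factor in the number of returns. *)
Lemma weight_shift p p' y : p' <= p ->
  weight p' y <= expR (- (p - p') * (count_mem a y)%:R) * weight p y.
Proof.
move=> pp'; rewrite /loop_weight -expRD ler_expR.
have : (count_mem a y)%:R <= (size y)%:R :> R by rewrite ler_nat count_size.
nra.
Qed.

(** Lowering the parameter makes the induced partition functions decay
exponentially, hence summable over the number of returns; this sum covers all
loops with many returns of which the first is [w], and prefixing powers of [w]
reaches the other loops. *)
Lemma gsum_lty_of_induced_le0 p p' w : rloop 1 w -> p' < p ->
  (induced_pressure M (fun x => (phi x + p)%R) a w <= 0)%E ->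
  (gsum p' (loop M a) < +oo)%E.
Proof.
move=> rw pp' P0; pose d := (p - p') / 2; have d0 : 0 < d by rewrite /d; lra.
have Pd : (induced_pressure M (fun x => (phi x + p)%R) a w < d%:E)%E.
  by apply: le_lt_trans P0 _; rewrite lte_fin.
have [N uN] := growth_rate_lt (induced_sum_ge0 p w) Pd.
apply: (@gsum_prefix_fin _ _ _ _ HB _ a (lpow N.+1 w) _
  (loop M a `&`
     [set y | (N < count_mem a y)%N /\ return_word a (periodic_point y) = w])) => //.
- by apply: loop_lpow; exact: rloop_loop rw.
- move=> y ly.
  have lpw n : loop M a (lpow n w ++ y) /\ (n <= count_mem a (lpow n w ++ y))%N.
    elim: n => // n [IHn cn]; rewrite lpowS -catA; split.
      by apply: loop_cat => //; exact: rloop_loop rw.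
    by rewrite count_cat; case: rw => _ ->; rewrite add1n ltnS.
  have [? ?] := lpw N.+1; split=> //; split=> //.
  rewrite lpowS -catA; apply: (return_word_per (M := M)) => //; right.
  by have [[]] := lpw N.
rewrite /loop_series (@esum_fiber _ _ (count_mem a))//; last by move=> y; exact: weighte_ge0.
apply: le_lt_trans (esum_geometric_lty d0); apply: le_esum => n _.
have [nN|Nn] := leqP n N.
  rewrite esum1 ?lee_fin ?expR_ge0// => y [[_ /= [+ _] yn]]; rewrite yn; lia.
apply: (@le_trans _ _ ((expR (- (p - p') * n%:R))%:E *
   gsum p (rloop n `&` [set y | return_word a (periodic_point y) = w]))%E).
  rewrite /loop_series -esumZl ?expR_ge0//; last by move=> y; exact: weighte_ge0.
  apply: (@le_esum_inj _ _ _ _ _ id) => // y [[ly [_ yw]] yn]; split=> //.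
  by rewrite -EFinM lee_fin -yn weight_shift// ltW.
rewrite -induced_periodic_esum ?(leq_trans _ Nn)//.
apply: le_trans (lee_wpmul2l _ (uN n (ltnW Nn))) _; first by rewrite lee_fin expR_ge0.
rewrite -EFinM -expRD lee_fin ler_expR /d; lra.
Qed.

(** A positive induced pressure provides finitely many loops of joint weight
beyond the distortion constant.  A finite sum is continuous in the
parameter, so they still do so slightly below [p], and their concatenations make
the series diverge there. *)
Lemma gsum_infty_of_induced_gt0 p w :
  (0 < induced_pressure M (fun x => (phi x + p)%R) a w)%E ->
  exists2 e : R, 0 < e & ~ (gsum (p - e) (loop M a) < +oo)%E.
Proof.
move=> P0; have [r r0 rP] : exists2 r : R, 0 < r &
    (r%:E < induced_pressure M (fun x => (phi x + p)%R) a w)%E.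
  move: P0; case: induced_pressure => [x|_|//]; last by exists 1; rewrite ?ltry.
  by rewrite lte_fin => x0; exists (x / 2); rewrite ?lte_fin; lra.
have [N NB] : exists N : nat, 3 * B <= r * N%:R.
  exists (Num.truncn (3 * B / r)).+1; rewrite -ler_pdivrMl// mulrC.
  by rewrite ltW// truncnS_gt.
have [k [Nk k0 kB]] : exists k, [/\ (N <= k)%N, (0 < k)%N
    & ((expR (r * k%:R))%:E <
       gsum p (rloop k `&` [set y | return_word a (periodic_point y) = w]))%E].
  apply: contrapT => Nk; move: rP; rewrite ltNge => /negP; apply.
  apply: (@growth_rate_le _ _ _ N.+1); first exact: induced_sum_ge0.
  move=> n Nn; rewrite leNgt; apply/negP => nr; apply: Nk; exists n.
  rewrite -induced_periodic_esum; first by split=> //; [exact: ltnW|exact: leq_trans Nn].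
  exact: leq_trans Nn.
have [s [us rs sB]] := esum_gt_seq kB.
set W := \sum_(y <- s) _ in sB.
have WB : expR (3 * B) < W.
  apply: le_lt_trans sB; rewrite ler_expR (le_trans NB)// ler_pM2l// ler_nat.
  exact: Nk.
have W0 : 0 < W by apply: lt_trans WB; exact: expR_gt0.
pose L : R := (\sum_(y <- s) size y)%N%:R + 1.
have L0 : 0 < L by rewrite /L; have : 0 <= (\sum_(y <- s) size y)%N%:R :> R by []; lra.
(* lowering the parameter by [e] divides each weight by at most [exp (e L)] *)
pose e := (ln W - 3 * B) / (2 * L).
have lnW : 3 * B < ln W by rewrite -ltr_expR lnK.
have e0 : 0 < e by rewrite /e divr_gt0//; lra.
exists e => //; case: k k0 Nk kB rs sB => // k _ _ _ rs sB.
refine (@gsum_loop_diverges _ k s us _ _); first by move=> y /rs[].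
apply: (@lt_le_trans _ _ (expR (- (e * L)) * W)).
  rewrite -[X in (_ < _ * X)%R]lnK ?posrE// -expRD ltr_expR.
  have -> : e * L = (ln W - 3 * B) / 2 by rewrite /e invfM mulrA mulfVK ?gt_eqF.
  lra.
rewrite /W mulr_sumr big_seq [leRHS]big_seq ler_sum// => y ys.
rewrite /loop_weight -expRD ler_expR.
have : (size y)%:R <= L.
  rewrite /L (le_trans (_ : _ <= (\sum_(z <- s) size z)%N%:R))//; last lra.
  by rewrite ler_nat (big_rem y ys)/= leq_addr.
nra.
Qed.

Variable P : R.
Hypothesis PE : pressure M phi a = P%:E.

Lemma p_star_gt w : rloop 1 w -> ((- P)%:E < p_star M phi a w)%E ->
  exists2 p, - P < p & (gsum p (rloop 1) < +oo)%E.
Proof.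
move=> rw /ereal_sup_gt[_ [p /= Pp <-]]; rewrite lte_fin => Plt.
by exists p => //; exact: gsum_first_return_lty Pp.
Qed.

(** At the critical parameter [q], a positive induced pressure forces
[q > - P], since the full series diverges already at some parameter below [q];
conversely, a nonpositive one would make the full series converge between [- P]
and [q]. *)
Lemma discriminant_gt0P w : rloop 1 w ->
  (0 < discriminant M phi a w)%E <-> exists2 p, - P < p & (gsum p (rloop 1) < +oo)%E.
Proof.
move=> rw; split=> [|[p0 Pp0 Gp0]].
  rewrite /discriminant; case E : p_star => [q||//]; last first.
    by move=> _; apply: (p_star_gt rw); rewrite E ltry.
  move=> /gsum_infty_of_induced_gt0[e e0 Ge].
  apply: (p_star_gt rw); rewrite E lte_fin; rewrite ltNge; apply/negP => qP.
  apply: Ge; rewrite -(opprK (q - e)); apply: (gsum_lty_of_pressure HB).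
  by rewrite PE lte_fin; lra.
have p0star : (p0%:E <= p_star M phi a w)%E.
  by apply: ereal_sup_ubound; exists p0 => //; exact: induced_pressure_lty.
rewrite /discriminant; case E : (p_star M phi a w) p0star => [q||//]; last first.
  by move=> _; exact: ltry.
rewrite lee_fin => p0q; rewrite ltNge; apply/negP => Pq.
have qP : (q - P) / 2 < q by lra.
have := gsum_lty_of_induced_le0 rw qP Pq.
by move=> /(pressure_le_of_gsum); rewrite PE lee_fin; lra.
Qed.

End Discriminant.

(** * Insertions of loops *)

Section Insertions.
Variables (T : eqType) (ins : T -> option (seq T)).

Fixpoint insertions (w : seq T) : seq (seq T) :=
  if w is x :: w' then
    map (cons x) (insertions w') ++
    (if ins x is Some g then map (fun r => g ++ x :: r) (insertions w') else [::])
  else [:: [::]].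

Lemma insertionsP x w r : reflect
  (exists2 r', r' \in insertions w &
     r = x :: r' \/ exists2 g, ins x = Some g & r = g ++ x :: r')
  (r \in insertions (x :: w)).
Proof.
rewrite /= mem_cat; apply: (iffP orP) => [[/mapP[r' r'w ->]|]|[r' r'w [->|[g gx ->]]]].
- by exists r' => //; left.
- case gx: (ins x) => [g|//] /mapP[r' r'w ->]; exists r' => //.
  by right; exists g.
- by left; apply/mapP; exists r'.
- by right; rewrite gx; apply/mapP; exists r'.
Qed.

(** Each eligible letter gives a choice between [1] and at least [c], whence
the factor [1 + c].  The prefix [u] is the part where the choices have been made. *)
Lemma insertions_weight (R : realType) (inv : seq T -> Prop) (W : seq T -> R) (c : R) :
  0 <= c ->
  (forall u x v g, inv (u ++ x :: v) -> ins x = Some g ->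
     inv (u ++ g ++ x :: v) /\ c * W (u ++ x :: v) <= W (u ++ g ++ x :: v)) ->
  forall w u, inv (u ++ w) ->
    (forall r, r \in insertions w -> inv (u ++ r)) /\
    (1 + c) ^+ count (isSome \o ins) w * W (u ++ w)
      <= \sum_(r <- insertions w) W (u ++ r).
Proof.
move=> c0 H; elim=> [|x w IHw] u uw.
  by split=> [r|]; rewrite ?inE ?big_seq1 ?expr0 ?mul1r// => /eqP->.
have uxw : inv (rcons u x ++ w) by rewrite cat_rcons.
have [inv1 W1] := IHw _ uxw.
have S1 : \sum_(r <- insertions w) W (rcons u x ++ r) =
    \sum_(r <- insertions w) W (u ++ x :: r).
  by apply: eq_bigr => r _; rewrite cat_rcons.
rewrite S1 cat_rcons in W1.
case gx : (ins x) => [g|]; last first.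
  split=> [r /insertionsP[r' r'w [->|[g]]]|]; last 1 first.
  - by rewrite /= gx cats0 add0n big_map.
  - by rewrite -cat_rcons; exact: inv1.
  - by rewrite gx.
have [ugxw W2] := H _ _ _ _ uw gx.
have ugxw' : inv ((u ++ g ++ [:: x]) ++ w) by rewrite -!catA.
have [inv2 W3] := IHw _ ugxw'.
have S3 : \sum_(r <- insertions w) W ((u ++ g ++ [:: x]) ++ r) =
    \sum_(r <- insertions w) W (u ++ g ++ x :: r).
  by apply: eq_bigr => r _; rewrite -!catA.
rewrite S3 -!catA in W3.
split=> [r /insertionsP[r' r'w [->|[g' + ->]]]|].
- by rewrite -cat_rcons; exact: inv1.
- by rewrite gx => -[<-]; have := inv2 _ r'w; rewrite -!catA.
rewrite /= gx big_cat/= !big_map /= add1n exprS.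
apply: le_trans (lerD W1 W3).
have e0 : 0 <= (1 + c) ^+ count (isSome \o ins) w by apply: exprn_ge0; lra.
have := ler_wpM2l e0 W2; rewrite /=; lra.
Qed.

End Insertions.

Section Decoding.
Variables (a b : nat) (g : seq nat).
Hypotheses (ab : b != a) (ga : a \in g) (gb : ohead g = Some b).

(** The word [g] contains [a] while the words that receive it do not; the first
occurrence of [a] is earliest when the first letter is preceded by an insertion,
which allows decoding letter by letter. *)
Definition insert_at (x : nat) := if x == b then Some g else None.

Lemma insertions_at_index w r : a \notin w -> r \in insertions insert_at w ->
  a \in r -> (index a g <= index a r)%N.
Proof.
elim: w r => [|x w IHw] r; first by move=> _; rewrite inE => /eqP->.
rewrite inE negb_or => /andP[ax aw] /insertionsP[r' r'w [->|[g' gx ->]]].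
  rewrite inE (negPf ax) /= eq_sym (negPf ax) => ar'.
  by rewrite (leq_trans (IHw _ aw r'w ar')).
move: gx; rewrite /insert_at; case: ifP => // _ [<-] _.
by rewrite index_cat ga.
Qed.

(** The left-hand side starts with an untouched letter, so its first [a] comes
strictly later than in [g]. *)
Lemma insertions_at_clash w (x : nat) r r' : a \notin w ->
  r \in insertions insert_at w -> x :: r = g ++ b :: r' -> False.
Proof.
move=> aw rw E; have xb : x = b by case: (g) gb E => // ? ? [->] [].
have ar : a \in r.
  have : a \in x :: r by rewrite E mem_cat ga.
  by rewrite inE xb eq_sym (negPf ab).
have := congr1 (index a) E; rewrite index_cat ga /= xb (negPf ab).
by have := insertions_at_index aw rw ar; lia.
Qed.

Lemma insertions_at_uniq w : a \notin w -> uniq (insertions insert_at w).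
Proof.
elim: w => // x w IHw; rewrite inE negb_or => /andP[ax aw] /=.
rewrite cat_uniq map_inj_uniq ?IHw//=; last by move=> r r' [].
rewrite /insert_at; case: eqP => //= ->.
rewrite map_inj_uniq ?IHw//; last first.
  by move=> r r' /eqP; rewrite eqseq_cat// eqxx => /eqP[].
rewrite andbT; apply/hasPn => _ /mapP[r rw ->]; apply/negP => /mapP[r' r'w].
by move/esym => E; exact: (insertions_at_clash aw r'w E).
Qed.

Lemma insertions_at_inj w w' r : a \notin w -> a \notin w' ->
  r \in insertions insert_at w -> r \in insertions insert_at w' -> w = w'.
Proof.
have nil_notin x v : [::] \notin insertions insert_at (x :: v).
  apply/negP => /insertionsP[r' _ [//|[g' _]]].
  by case: g'.
elim: w w' r => [|x w IHw] [|x' w'] r //.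
- by move=> _ _; rewrite inE => /eqP->; rewrite (negPf (nil_notin _ _)).
- by move=> _ _ rw; rewrite inE => /eqP rE; move: rw; rewrite rE (negPf (nil_notin _ _)).
rewrite !inE !negb_or => /andP[ax aw] /andP[ax' aw'].
move=> /insertionsP[r1 r1w [->|[g1 + ->]]] /insertionsP[r2 r2w [|[g2 + ]]].
- by case=> -> E; rewrite (IHw w' r2)// -E.
- rewrite /insert_at; case: eqP => // -> [<-] E.
  by have := insertions_at_clash aw r1w E.
- rewrite {1}/insert_at; case: eqP => // -> [<-] E.
  by have := insertions_at_clash aw' r2w (esym E).
- rewrite /insert_at; case: eqP => // -> [<-]; case: eqP => // -> [<-] /eqP.
  by rewrite eqseq_cat// eqxx => /eqP[r12]; rewrite (IHw w' r1)// r12.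
Qed.

End Decoding.

Section InsertionBounds.
Context {R : realType}.
Variables (M : rel nat) (phi : (nat -> nat) -> R) (B : R) (a : nat).
Hypothesis HB : bounded_distortion M phi B.
Implicit Types (y u v w g : seq nat) (p : R).

Local Notation weight := (loop_weight phi).
Local Notation gsum := (loop_series phi).
Local Notation rloop := (rloop M a).

(** The factor that an insertion of [g] multiplies weights with, at the least. *)
Definition gain p g : R := expR (- (3 * B)) * weight p g.

Lemma gain_gt0 p g : 0 < gain p g.
Proof. by rewrite mulr_gt0 ?expR_gt0. Qed.

Lemma gain_le p p' g : p <= p' -> gain p g <= gain p' g.
Proof. by move=> pp'; rewrite /gain ler_pM2l ?expR_gt0// ler_expR lerD2l ler_wpM2r. Qed.

(** Inserting [g] at subsets of the visits to [b] maps the left-hand side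
injectively into the loops at [a]. *)
Lemma gsum_visits_le p b g : b != a -> a \in g -> loop M b g ->
  (\esum_(y in rloop 1) (weight p y * (1 + gain p g) ^+ count_mem b y)%:E
     <= gsum p (loop M a))%E.
Proof.
move=> ba ga lg; have [hg _] := lg.
pose I y := insertions (insert_at b g) (behead y).
have insw y : rloop 1 y -> (forall r, r \in I y -> cycle M (a :: r)) /\
    weight p y * (1 + gain p g) ^+ count_mem b y <= \sum_(r <- I y) weight p (a :: r).
  move=> /rloop1P[s [yE sM sa]].
  have H u x v g' : cycle M (u ++ x :: v) -> insert_at b g x = Some g' ->
      cycle M (u ++ g' ++ x :: v) /\
      gain p g * weight p (u ++ x :: v) <= weight p (u ++ g' ++ x :: v).
    move=> cuv; rewrite /insert_at; case: eqP => // xb [<-].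
    have hv : ohead (x :: v) = Some b by rewrite xb.
    by rewrite (cycle_insert _ lg hv); split=> //; exact: weight_insert_ge lg hv cuv.
  have [cI] := @insertions_weight _ (insert_at b g) R (fun w => cycle M w)
    (weight p) (gain p g) (ltW (gain_gt0 p g)) H s [:: a] sM.
  rewrite mulrC {1}yE /I yE /= eq_sym (negPf ba) add0n => Ws; split=> //.
  rewrite (_ : count_mem b s = count (isSome \o insert_at b g) s)//.
  by apply: eq_count => x /=; rewrite /insert_at; case: ifP.
apply: (@le_trans _ _ (\esum_(y in rloop 1) \esum_(r in [set` I y]) (weight p (a :: r))%:E)%E).
  apply: le_esum => y ry; have [_ Wy] := insw _ ry.
  have /rloop1P[s [yE _ sa]] := ry.
  have uI : uniq (I y) by rewrite /I yE; exact: insertions_at_uniq sa.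
  apply: (@le_trans _ _ (\sum_(r <- I y) weight p (a :: r))%:E); first by rewrite lee_fin.
  exact: (@ge_esum_seq _ _ [set` I y] (fun r => weight p (a :: r))).

apply: (@ge_esum_esum _ _ _ _ _ _ (fun y => [set` I y]) (fun yr => a :: yr.2)).
- by move=> y r; exact: weighte_ge0.
- move=> [y r] [y' r']; rewrite !inE /= => -[ry Iy] [ry' Iy'] [rr'].
  have /rloop1P[s [yE _ sa]] := ry; have /rloop1P[s' [yE' _ sa']] := ry'.
  rewrite /I yE /= in Iy; rewrite /I yE' /= -rr' in Iy'.
  by rewrite rr' yE yE' (insertions_at_inj ba ga hg sa sa' Iy Iy').
- by move=> y r ry rI; split=> //; split=> //; have [cI _] := insw _ ry; exact: cI.
Qed.

Section TwoReturns.
Variables g1 g2 : seq nat.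
Hypotheses (rg1 : rloop 1 g1) (rg2 : rloop 1 g2) (g12 : g1 != g2).

(** Inserting before a return a return different from it keeps the choice
decodable from the first return of the result; a single fixed return
could not be told apart from its occurrences in the original loop. *)
Definition other_return (l : seq nat) := if l == g1 then g2 else g1.

Lemma other_return_neq l : other_return l != l.
Proof. by rewrite /other_return; have [->|lg1] := eqVneq l g1; rewrite eq_sym. Qed.

Lemma rloop_other l : rloop 1 (other_return l).
Proof. by rewrite /other_return; case: ifP. Qed.

Definition insert_other (l : seq nat) := Some [:: other_return l].

Lemma insertions_other_uniq L : uniq (insertions insert_other L).
Proof.
elim: L => // l L IHL /=.
rewrite cat_uniq !map_inj_uniq ?IHL ?andbT//=.
- apply/hasPn => _ /mapP[r rw ->]; apply/negP => /mapP[r' r'w [E _]].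
  by have := other_return_neq l; rewrite E eqxx.
- by move=> r r' [].
- by move=> r r' [].
Qed.

(** Each of the [k + 1] returns of [y] may be preceded by another return or
not, and all the resulting loops are different. *)
Lemma weight_returns_le p c k y : 0 <= c -> c <= gain p g1 -> c <= gain p g2 ->
  rloop k.+1 y ->
  (((1 + c) ^+ k.+1 * weight p y)%:E <= gsum p (loop M a))%E.
Proof.
move=> c0 cg1 cg2 /rloop_decompose[L [rL <- sL]].
have L0 : L != [::] by case: (L) sL.
pose inv (L' : seq (seq nat)) := L' != [::] /\ forall u, u \in L' -> rloop 1 u.
have H (u : seq (seq nat)) (x : seq nat) (v g' : seq (seq nat)) :
    inv (u ++ x :: v) -> insert_other x = Some g' ->
    inv (u ++ g' ++ x :: v) /\
    c * weight p (flatten (u ++ x :: v)) <= weight p (flatten (u ++ g' ++ x :: v)).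
  move=> [_ ruv] [<-]; split.
    split; first by case: (u).
    move=> z; rewrite mem_cat mem_cat orbCA => /orP[|zuv]; last first.
      by apply: ruv; rewrite mem_cat.
    by rewrite inE => /eqP->; exact: rloop_other.
  have [lo _] := rloop_other x.
  have luv : loop M a (flatten (u ++ x :: v)).
    by apply: loop_of_flatten ruv; case: (u).
  have hv : ohead (flatten (x :: v)) = Some a.
    have /rloop1P[s [-> _ _]] : rloop 1 x by apply: ruv; rewrite mem_cat mem_head orbT.
    by [].
  rewrite !flatten_cat [flatten [:: _]]/= cats0.
  have [_ +] := luv; rewrite flatten_cat => cuv.
  apply: le_trans (weight_insert_ge HB p lo hv cuv).
  rewrite ler_wpM2r ?weight_ge0// /other_return.
  by case: ifP.
have [invr] := @insertions_weight _ insert_other R inv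
  (fun K => weight p (flatten K)) c c0 H L [::] (conj L0 rL).
rewrite (_ : count _ L = k.+1); last by rewrite -sL; exact: count_predT.
rewrite !cat0s => /= Wr.
apply: (@le_trans _ _ (\sum_(r <- insertions insert_other L) weight p (flatten r))%:E).
  by rewrite lee_fin.
rewrite -(big_map flatten xpredT (weight p)).
rewrite /loop_series; set K := map _ _.
apply: (@ge_esum_seq _ _ (loop M a) (weight p) K).
- rewrite map_inj_in_uniq ?insertions_other_uniq// => r r' /invr[_ rr] /invr[_ rr'].
  exact: (@flatten_rloop_inj M a).
- by move=> _ /mapP[r /invr[r0 rr] ->]; exact: loop_of_flatten.
Qed.

End TwoReturns.

(** The alphabet is infinite and every letter lies on a first-return loop. *)
Lemma exists_two_returns : topologically_transitive M ->
  exists g1 g2, [/\ rloop 1 g1, rloop 1 g2 & g1 != g2].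
Proof.
move=> Mtrans.
have ret b : exists2 g, rloop 1 g & b \in g.
  have [u [v luv]] := transitive_loop Mtrans a b.
  have := loop_count luv; case E : (count_mem a _) => [//|k] _.
  have [L [rL LE _]] := @rloop_decompose M a k _ (conj luv E).
  have : b \in flatten L by rewrite LE inE mem_cat mem_head !orbT.
  by move=> /flattenP[g gL bg]; exists g => //; exact: rL.
have [g1 rg1 _] := ret 0%N; have [g2 rg2 bg2] := ret (sumn g1).+1.
exists g1, g2; split=> //; apply/eqP => g12; move: bg2; rewrite -g12.
suff H s x : x \in s -> (x <= sumn s)%N by move/H; rewrite ltnn.
elim: s => //= z s IHs; rewrite inE => /predU1P[->|/IHs]; first exact: leq_addr.
by move=> /leq_trans; apply; exact: leq_addl.
Qed.

End InsertionBounds.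

(** * Strong positive recurrence implies a gap in the periodic averages *)

Section SPRGap.
Context {R : realType}.
Variables (M : rel nat) (phi : (nat -> nat) -> R) (B : R).
Hypothesis HB : bounded_distortion M phi B.
Hypothesis Mtrans : topologically_transitive M.
Implicit Types (y u v w g : seq nat) (p : R).

Local Notation weight := (loop_weight phi).
Local Notation gsum := (loop_series phi).
Local Notation lsum := (loop_sum phi).

Lemma pressure_le a b : (pressure M phi b <= pressure M phi a)%E.
Proof.
rewrite leNgt; apply/negP => ab.
have [r ar rb] : exists2 r : R, (pressure M phi a < r%:E)%E & (r%:E < pressure M phi b)%E.
  move: ab; case: (pressure M phi a) => [x||]; case: (pressure M phi b) => [z||] //=.
  - by rewrite lte_fin => xz; exists ((x + z) / 2); rewrite lte_fin; lra.
  - by exists (x + 1); rewrite ?ltry// lte_fin; lra.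
  - by exists (z - 1); rewrite ?ltNyr// lte_fin; lra.
  - by exists 0; rewrite ?ltNyr ?ltry.
have := pressure_le_of_gsum (gsum_base HB Mtrans b (gsum_lty_of_pressure HB ar)).
by rewrite opprK leNgt rb.
Qed.

Lemma pressure_base a b : pressure M phi a = pressure M phi b.
Proof. by apply/eqP; rewrite eq_le !pressure_le. Qed.

Lemma weight_le_gsum p a y : loop M a y -> (gsum p (loop M a) < +oo)%E ->
  weight p y <= fine (gsum p (loop M a)).
Proof.
move=> ly Gfin; rewrite -lee_fin fineK ?ge0_fin_numE ?gsum_ge0//.
by apply: (ge_esum1 (f := fun y => (weight p y)%:E)) => //; exact: weighte_ge0.
Qed.

(** The powers of a single loop already grow at a finite exponential rate. *)
Lemma pressure_gtNy a : (-oo < pressure M phi a)%E.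
Proof.
have [u [v lg]] := transitive_loop Mtrans a a; set g := a :: _ in lg.
have g0 : 0 < (size g)%:R :> R by rewrite ltr0n (loop_size lg).
apply: (@lt_le_trans _ _ (lsum g / (size g)%:R)%:E); first exact: ltNyr.
rewrite leNgt; apply/negP => /lte_EFin_dense[r rg /(gsum_lty_of_pressure HB) Gfin].
suff : weight (- r) g <= 1.
  rewrite -expR0 ler_expR; move: rg; rewrite ltr_pdivlMr//; lra.
apply: (@expr_bounded_le1 _ _ (Num.max 1 (fine (gsum (- r) (loop M a))))); first exact: weight_gt0.
case=> [|j]; first by rewrite expr0 le_max lexx.
rewrite -weight_lpow ?(loop_size lg)// le_max (weight_le_gsum _ Gfin) ?orbT//.
exact: loop_lpow.
Qed.

Section Gap.
Variables (a : nat) (P p0 : R).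
Hypotheses (PE : pressure M phi a = P%:E) (Pp0 : - P < p0)
  (Gp0 : (gsum p0 (rloop M a 1) < +oo)%E).

(** Both bounds of a loop with [n] visits are linear in [n]: the first says
that many visits lower the Birkhoff sum relative to [- p], the second that few visits
lower it relative to [- p0].  The constants [d] and [k] are the two slopes, and
the combination of both bounds with these weights eliminates [n].  They do not
depend on [p] within the given range, so that [p] can tend to [- P] afterwards. *)
Lemma loop_gap : exists d k : R, [/\ 0 < d, 0 < k & forall p, - P - 1 <= p -> p < - P ->
  exists E : R, forall y, loop M a y ->
    (d + k) * lsum y + (d * p + k * p0) * (size y)%:R <= E].
Proof.
have [D D1 GD] := gsum_rloop_le HB Gp0.
have [g1 [g2 [rg1 rg2 g12]]] := exists_two_returns a Mtrans.
have D0 : 0 < D by apply: lt_le_trans D1.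
have lnD : 0 <= ln D by rewrite ln_ge0.
pose c := Num.min (gain phi B (- P - 1) g1) (gain phi B (- P - 1) g2).
have c0 : 0 < c by rewrite lt_min !gain_gt0.
have k0 : 0 < ln (1 + c) by rewrite ln_gt0// ltrDl.
exists (ln D + 1), (ln (1 + c)); split => // [|p pP1 pP]; first lra.
have Gfin : (gsum p (loop M a) < +oo)%E.
  by rewrite -(opprK p); apply: (gsum_lty_of_pressure HB); rewrite PE lte_fin; lra.
have cp1 : c <= gain phi B p g1 by apply: le_trans (gain_le phi B g1 pP1); rewrite ge_min lexx.
have cp2 : c <= gain phi B p g2 by apply: le_trans (gain_le phi B g2 pP1); rewrite ge_min lexx orbT.
set K := fine (gsum p (loop M a)).
exists ((ln D + 1) * ln K) => y ly.
have := loop_count ly; case cy : (count_mem a y) => [//|k] _.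
have ry : rloop M a k.+1 y by split.
have K0 : 0 < K by apply: lt_le_trans (weight_le_gsum ly Gfin); exact: weight_gt0.
have H1 : ln (1 + c) * k.+1%:R + (lsum y + p * (size y)%:R) <= ln K.
  have := weight_returns_le HB rg1 rg2 g12 (ltW c0) cp1 cp2 ry.
  rewrite -(fineK (_ : gsum p (loop M a) \is a fin_num)) ?ge0_fin_numE ?gsum_ge0//.
  rewrite lee_fin -/K -ler_ln ?posrE//; last first.
    by rewrite mulr_gt0 ?exprn_gt0 ?weight_gt0//; lra.
  rewrite lnM ?posrE ?exprn_gt0 ?weight_gt0//; [|lra..].
  by rewrite /loop_weight expRK lnXn ?mulr_natr//; lra.
have H2 : lsum y + p0 * (size y)%:R <= k.+1%:R * (ln D + 1).
  have : (weight p0 y <= D ^+ k.+1).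
    rewrite -lee_fin; apply: le_trans (GD k).
    by apply: (ge_esum1 (f := fun y => (weight p0 y)%:E)) => //; exact: weighte_ge0.
  rewrite -ler_ln ?posrE ?exprn_gt0 ?weight_gt0// lnXn// -[ln D *+ _]mulr_natl.
  rewrite /loop_weight expRK => Hw; apply: (le_trans Hw).
  by rewrite ler_pM2l ?ltr0n// lerDl.
have H1' := ler_wpM2l (_ : 0 <= ln D + 1) H1.
have H2' := ler_wpM2l (ltW k0) H2.
have {}H1' := H1' ltac:(lra).
lra.
Qed.

(** The orbit is repeated [j] times within a fixed loop at [a], and the
constant [E] disappears as [j] grows. *)
Lemma periodic_of_loop (d k p E : R) (x : nat -> nat) n : 0 < d -> 0 < k ->
  (forall y, loop M a y ->
    (d + k) * lsum y + (d * p + k * p0) * (size y)%:R <= E) ->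
  shift_space M x -> (0 < n)%N -> iter n shift_map x = x ->
  (d + k) * birkhoff_sum shift_map phi n x + (d * p + k * p0) * n%:R <= 0.
Proof.
move=> d0 k0 HE Mx n0 xn.
pose b := x 0%N; pose z := mkseq x n.
have lz : loop M b z by exact: loop_mkseq.
have Sz : lsum z = birkhoff_sum shift_map phi n x.
  by rewrite /loop_sum size_mkseq per_mkseq.
have [u [v luv]] := transitive_loop Mtrans a b.
set S := birkhoff_sum _ _ _ _ in Sz *.
set N0 := (size (a :: u ++ b :: v))%:R : R.
set S0 := lsum (a :: u ++ b :: v).
(* what is left of [E] once the contribution of the [j] repetitions is removed *)
pose K := E - (d + k) * (S0 - 3 * B) - (d * p + k * p0) * N0.
apply: (@natmul_bounded_le0 _ _ (Num.max 0 K)) => -[|j].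
  by rewrite mul0r le_max lexx.
rewrite le_max; apply/orP; right.
have lj := loop_lpow j lz; have [_ cuv] := luv.
have ly : loop M a ((a :: u) ++ lpow j.+1 z ++ b :: v).
  by split=> //; rewrite (cycle_insert _ lj).
have sE : (size ((a :: u) ++ lpow j.+1 z ++ b :: v))%:R = j.+1%:R * n%:R + N0.
  rewrite /N0 -natrM -natrD; congr (_%:R).
  by rewrite !size_cat addnCA size_lpow size_mkseq -size_cat.
have := HE _ ly; rewrite sE.
have := @lsum_insert _ _ _ _ HB b (a :: u) _ (b :: v) lj erefl cuv.
rewrite lsum_lpow ?(loop_size lz)// Sz -/S0 ler_norml => /andP[+ _].
rewrite -mulr_natl.
set L := lsum _ => HL.
have := ler_wpM2l (_ : 0 <= d + k) HL => /(_ ltac:(lra)).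
rewrite /K; lra.
Qed.

Lemma chi_per_lt_pressure : (chi_per M phi < P%:E)%E.
Proof.
have [d [k [d0 k0 H]]] := loop_gap.
have pP : 0 < p0 + P by rewrite addrC -ltrBlDl sub0r.
(* at the parameter [- P - t] the rate is [P - (k (p0 + P) - d t) / (d + k)] *)
pose t := Num.min 1 (k * (p0 + P) / (2 * d)).
have t0 : 0 < t.
  by rewrite lt_min ltr01 divr_gt0 ?mulr_gt0.
have dt : d * t <= k * (p0 + P) / 2.
  apply: (@le_trans _ _ (d * (k * (p0 + P) / (2 * d)))).
    by rewrite ler_pM2l// ge_min lexx orbT.
  by rewrite le_eqVlt; apply/orP; left; apply/eqP; field; rewrite gt_eqF.
have t1 : t <= 1 by rewrite ge_min lexx.
have [E HE] := H (- P - t) ltac:(lra) ltac:(lra).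
pose X := P - k * (p0 + P) / (2 * (d + k)).
have XP : X < P by rewrite /X gtrBl divr_gt0// mulr_gt0//; lra.
apply: (@le_lt_trans _ _ X%:E); last by rewrite lte_fin.
apply: ge_ereal_sup => _ [x [n [Mx n0 xn ->]]]; rewrite lee_fin.
have := periodic_of_loop d0 k0 HE Mx n0 xn; set S := birkhoff_sum _ _ _ _ => HS.
have n0' : 0 < n%:R :> R by rewrite ltr0n.
rewrite ler_pdivrMl//.
have dk : 0 < d + k by lra.
rewrite -(ler_pM2l dk).
have -> : (d + k) * (n%:R * X) = n%:R * ((d + k) * P - k * (p0 + P) / 2).
  by rewrite /X; field; rewrite gt_eqF.
have := ler_wpM2l (ltW n0') dt; lra.
Qed.

End Gap.

End SPRGap.

(** * A gap in the periodic averages implies strong positive recurrence *)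

Section GapSPR.
Context {R : realType}.
Variables (M : rel nat) (phi : (nat -> nat) -> R) (B : R) (a : nat).
Hypothesis HB : bounded_distortion M phi B.
Hypothesis Mtrans : topologically_transitive M.
Implicit Types (y u v w g : seq nat) (p : R).

Local Notation weight := (loop_weight phi).
Local Notation gsum := (loop_series phi).
Local Notation lsum := (loop_sum phi).
Local Notation rloop := (rloop M a).

(** Insertions are needed at finitely many letters only, hence with a common
gain. *)
Lemma uniform_gain p q : exists2 c : R, 0 < c & forall b, (b < q)%N ->
  exists g, [/\ loop M b g, a \in g & c <= gain phi B p g].
Proof.
elim: q => [|q [c c0 Hc]]; first by exists 1.
have [u [v lg]] := transitive_loop Mtrans q a; set g := q :: _ in lg.
exists (Num.min c (gain phi B p g)); first by rewrite lt_min c0 gain_gt0.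
move=> b; rewrite ltnS leq_eqVlt => /predU1P[->|/Hc[g' [lg' ag' cg']]].
  exists g; rewrite ge_min lexx orbT; split=> //.
  by rewrite /g inE mem_cat mem_head !orbT.
by exists g'; rewrite ge_min cg'.
Qed.

Lemma count_below q y : (\sum_(b < q) count_mem (b : nat) y = count (fun i => i < q) y)%N.
Proof.
elim: y => [|x y IHy]; first by rewrite big1.
rewrite /= big_split/= IHy; congr addn.
have [xq|qx] := ltnP x q.
  rewrite (bigD1 (Ordinal xq))//= eqxx big1 ?addn0// => i.
  by rewrite -val_eqE /= eq_sym => /negPf->.
by rewrite big1// => i _; rewrite (_ : (x == i) = false)//; have := ltn_ord i; lia.
Qed.

(** Apart from the single visit to [a], fewer than [q] letters share the visits
to the letters below [q]. *)
Lemma frequent_letter q y : rloop 1 y -> (a < q)%N ->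
  count (fun i => i < q)%N y = 1%N \/ exists b, [/\ (b < q)%N, b != a
    & (count (fun i => i < q) y <= 1 + q * count_mem b y)%N].
Proof.
move=> [_ ca] aq; rewrite -count_below (bigD1 (Ordinal aq))//= ca.
set Q := (\sum_(b < q | _) _)%N.
have [->|Q0] := posnP Q; first by left.
right; apply: contrapT => Hb.
have H (b : 'I_q) : b != Ordinal aq -> (q * count_mem (b : nat) y <= Q.-1)%N.
  move=> ba; rewrite -ltnS prednK// ltnNge; apply/negP => Qb; apply: Hb.
  by exists b; rewrite ltn_ord.
have : (q * Q <= q * Q.-1)%N.
  rewrite {1}/Q big_distrr/=.
  apply: (@leq_trans (\sum_(b < q | b != Ordinal aq) Q.-1)%N); first exact: leq_sum.
  rewrite sum_nat_const leq_mul2r; apply/orP; right.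
  by apply: leq_trans (max_card _) _; rewrite card_ord.
by rewrite leq_pmul2l ?(leq_ltn_trans _ aq)//; case: (Q) Q0 => //= n _; rewrite ltnn.
Qed.

Definition few_visits q m : set (seq nat) := [set y |
  (count (fun i => i.+1 <= q)%N (rcons y a))%:R <= (size y).+1%:R / m%:R :> R].

Lemma num_few_visits q m n : (a < q)%N ->
  (\esum_(y in (rloop 1 `&` few_visits q m) `&` [set y | size y = n]) 1
     <= num_escaping R M n m q)%E.
Proof.
move=> aq; apply: (@le_esum_inj _ _ _ _ _ (fun y => cylinder M (rcons y a))).
- have inC y : rloop 1 y -> cylinder M (rcons y a) (periodic_point y).
    move=> [ly _]; split; first exact: per_loop ly.
    move=> i; rewrite size_rcons ltnS leq_eqVlt => /predU1P[->|iy].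
      rewrite nth_rcons ltnn eqxx -[X in periodic_point _ X]addn0 per_shift.
      by case: ly => /per_head.
    by rewrite nth_rcons iy per_nth.
  move=> y z; rewrite !inE => -[[ry _] /= yn] [[rz _] /= zn] yz.
  have [_ Hz] : cylinder M (rcons z a) (periodic_point y).
    by rewrite -yz; exact: inC.
  apply: (@eq_from_nth _ 0%N); first by rewrite yn zn.
  move=> i iy; have := Hz i; rewrite size_rcons zn -yn ltnS => /(_ (ltnW iy)).
  by rewrite nth_rcons zn -yn iy per_nth.
- move=> y [[ry fy] /= yn]; split=> //; exists (rcons y a).
  have /rloop1P[s [yE sM _]] := ry; split=> //.
  + by rewrite size_rcons yn; split=> //; rewrite yE.
  + by rewrite yE.
  + by rewrite nth_rcons -yn ltnn eqxx.
  + by move: fy; rewrite /few_visits /= yn.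
Qed.

Variables (X P : R).
Hypotheses (PE : pressure M phi a = P%:E) (chiX : (chi_per M phi <= X%:E)%E).

Lemma lsum_le_chi y : loop M a y -> lsum y <= X * (size y)%:R.
Proof.
move=> ly; have y0 := loop_size ly.
rewrite mulrC -ler_pdivrMl ?ltr0n// -lee_fin; apply: le_trans chiX.
apply: ereal_sup_ubound; exists (periodic_point y), (size y); split=> //.
  exact: per_loop ly.
exact: iter_per.
Qed.

Lemma gsum_loop_lty p : p < - P -> (gsum p (loop M a) < +oo)%E.
Proof.
by move=> pP; rewrite -(opprK p); apply: (gsum_lty_of_pressure HB); rewrite PE lte_fin; lra.
Qed.

(** On loops of bounded length a change of the parameter costs a bounded
factor, so that convergence follows from the one below [- P]. *)
Lemma gsum_short_lty p N A : A `<=` loop M a ->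
  (gsum p (A `&` [set y | (size y < N)%N]) < +oo)%E.
Proof.
move=> Aa; pose p' := Num.min p (- P - 1).
have p'P : p' < - P by rewrite gt_min; apply/orP; right; lra.
have p'p : p' <= p by rewrite ge_min lexx.
apply: (@le_lt_trans _ _ ((expR ((p - p') * N%:R))%:E * gsum p' (loop M a))%E).
  rewrite /loop_series -esumZl ?expR_ge0//; last by move=> y; exact: weighte_ge0.
  apply: (@le_esum_inj _ _ _ _ _ id) => // y [Ay /= yN]; split; first exact: Aa.
  rewrite -EFinM lee_fin /loop_weight -expRD ler_expR.
  have : (size y)%:R <= N%:R :> R by rewrite ler_nat ltnW.
  nra.
by rewrite lte_mul_pinfty ?lee_fin ?expR_ge0// gsum_loop_lty.
Qed.

(** There are at most [exp (d n)] such loops of length [n], each of weight at most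
[exp ((p + X) n)]. *)
Lemma gsum_few_lty p d q m : (a < q)%N -> p + X + d < 0 ->
  (growth_rate (fun n => num_escaping R M n m q) < d%:E)%E ->
  (gsum p (rloop 1 `&` few_visits q m) < +oo)%E.
Proof.
move=> aq pXd gr; have [|N zN] := growth_rate_lt _ gr.
  by move=> n; apply: esum_ge0.
rewrite /loop_series (esumID [set y | (size y < N)%N])//; last by move=> y _; exact: weighte_ge0.
rewrite lte_add_pinfty//.
  by apply: gsum_short_lty => y [[]].
set A := _ `&` ~` _.
rewrite (@esum_fiber _ _ size)//; last by move=> y; exact: weighte_ge0.
have e0 : 0 < - (p + X + d) by lra.
apply: le_lt_trans (esum_geometric_lty e0); apply: le_esum => n _.
have [nN|Nn] := ltnP n N.
  by rewrite esum1 ?lee_fin ?expR_ge0// => y [[_ /= + yn]]; rewrite yn nN.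
apply: (@le_trans _ _ ((expR ((p + X) * n%:R))%:E *
   \esum_(y in (rloop 1 `&` few_visits q m) `&` [set y | size y = n]) 1)%E).
  rewrite -esumZl ?expR_ge0//.
  apply: (@le_esum_inj _ _ _ _ _ id) => // y [[[ry fy] _] /= yn]; split=> //.
  rewrite mule1 lee_fin /loop_weight ler_expR -yn.
  have := lsum_le_chi (rloop_loop ry); lra.
apply: (@le_trans _ _ ((expR ((p + X) * n%:R))%:E * (expR (d * n%:R))%:E)%E).
  apply: lee_wpmul2l; first by rewrite lee_fin expR_ge0.
  by apply: le_trans (num_few_visits _ _ aq) _; exact: zN.
by rewrite -EFinM -expRD lee_fin ler_expR; lra.
Qed.

(** Multiplying the weight by [exp (k |y|)] is compensated by the gain of the
insertions at the letter that [y] visits most often; [k] is chosen accordingly. *)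
Lemma gsum_many_lty q m : (a < q)%N -> (0 < m)%N -> exists2 k : R, 0 < k &
  forall p, p <= - P + k -> (gsum p (rloop 1 `&` ~` few_visits q m) < +oo)%E.
Proof.
move=> aq m0; have [c c0 Hc] := uniform_gain (- P - 1) q.
have l0 : 0 < ln (1 + c) by rewrite ln_gt0// ltrDl.
have q0 : 0 < q%:R :> R by rewrite ltr0n (leq_ltn_trans _ aq).
have m0' : 0 < m%:R :> R by rewrite ltr0n.
(* A loop of length [n] has more than [n / m] visits below [q], hence about
   [n / (m q)] visits to its most frequent letter. *)
pose k := ln (1 + c) / (m%:R * q%:R); have k0 : 0 < k by rewrite divr_gt0 ?mulr_gt0.
exists (k / 2) => [|p1 p1P]; first lra.
pose p := Num.max (- P - 1) (p1 - k).
have pP : p < - P by rewrite gt_max; apply/andP; split; lra.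
have pP1 : - P - 1 <= p by rewrite le_max lexx.
have p1p : p1 - k <= p by rewrite le_max lexx orbT.
have visits b : (b < q)%N -> b != a ->
    (\esum_(y in rloop 1) (weight p y * (1 + c) ^+ count_mem b y)%:E < +oo)%E.
  move=> bq ba; have [g [lg ag cg]] := Hc b bq.
  apply: le_lt_trans (gsum_loop_lty pP).
  apply: le_trans (gsum_visits_le HB p ba ag lg); apply: le_esum => y _.
  have cp := le_trans cg (gain_le phi B g pP1).
  rewrite lee_fin ler_pM2l ?weight_gt0//; apply: lerXn2r; rewrite ?nnegrE; lra.
pose F y := weight p y + \sum_(b < q | b != a :> nat) weight p y * (1 + c) ^+ count_mem (b : nat) y.
have F0 y (b : nat) : 0 <= weight p y * (1 + c) ^+ count_mem b y.
  by rewrite mulr_ge0 ?weight_ge0 ?exprn_ge0//; lra.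
apply: (@le_lt_trans _ _ ((expR (2 * m%:R * k))%:E * \esum_(y in rloop 1) (F y)%:E)%E).
  rewrite /loop_series -esumZl ?expR_ge0//; last first.
    by move=> y; rewrite lee_fin addr_ge0 ?weight_ge0// sumr_ge0.
  apply: (@le_esum_inj _ _ _ _ _ id) => // y [ry fy]; split=> //.
  rewrite -EFinM lee_fin.
  have wp : weight p1 y <= expR (k * (size y)%:R) * weight p y.
    rewrite /loop_weight -expRD ler_expR.
    have : 0 <= (size y)%:R :> R by []. 
    nra.
  apply: (le_trans wp).
  have yk : k * (size y)%:R <= k * m%:R * ((count (fun i => i < q)%N y).+1)%:R.
    rewrite -mulrA ler_pM2l//; move: fy; rewrite /few_visits /= => /negP.
    rewrite -ltNge ltr_pdivrMr// -cats1 count_cat /= aq addn1 mulrC.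
    by rewrite -natr1; lra.
  have [c1|[b [bq ba cb]]] := frequent_letter ry aq.
    apply: (@le_trans _ _ (expR (2 * m%:R * k) * weight p y)).
      rewrite ler_pM2r ?weight_gt0// ler_expR (le_trans yk)// c1; lra.
    by rewrite ler_pM2l ?expR_gt0// lerDl sumr_ge0.
  apply: (@le_trans _ _ (expR (2 * m%:R * k) * (weight p y * (1 + c) ^+ count_mem b y))).
    rewrite mulrCA [leLHS]mulrC ler_pM2l ?weight_gt0//.
    rewrite -[1 + c]lnK ?posrE; last by lra.
    rewrite -expRM_natr -expRD ler_expR (le_trans yk)//.
    have : k * m%:R * q%:R = ln (1 + c).
      by rewrite /k -mulrA mulfVK// gt_eqF// mulr_gt0.
    have : (count (fun i => i < q)%N y)%:R <= 1 + q%:R * (count_mem b y)%:R :> R.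
      by rewrite -natrM -(natrD _ 1) ler_nat.
    rewrite -natr1 => Hc' <-.
    have km0 : 0 <= k * m%:R by rewrite mulr_ge0 ?ltW.
    have := ler_wpM2l km0 Hc'; lra.
  rewrite ler_pM2l ?expR_gt0// /F (bigD1 (Ordinal bq))//=.
  rewrite [leRHS]addrCA lerDl addr_ge0 ?weight_ge0// sumr_ge0//.
rewrite lte_mul_pinfty ?lee_fin ?expR_ge0//.
have -> : (\esum_(y in rloop 1) (F y)%:E = \esum_(y in rloop 1) (weight p y)%:E +
    \esum_(y in rloop 1)
      \sum_(b < q | b != a :> nat) (weight p y * (1 + c) ^+ count_mem (b : nat) y)%:E)%E.
  rewrite -esumD.
  - by apply: eq_esum => y _; rewrite EFinD sumEFin.
  - by move=> y _; exact: weighte_ge0.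
  - by move=> y _; apply: sume_ge0 => b _; rewrite lee_fin.
rewrite lte_add_pinfty//.
  by apply: le_lt_trans (gsum_loop_lty pP); apply: esum_subset; exact: rloop_loop.
rewrite esum_sum; last by move=> y b _ _; rewrite lee_fin.
by apply: lte_sum_pinfty => b ba; exact: visits.
Qed.

Lemma first_return_gap : X < P -> entropy_at_infinity R M = 0%E ->
  exists2 p, - P < p & (gsum p (rloop 1) < +oo)%E.
Proof.
move=> XP h0; pose d := (P - X) / 4.
have hd : (entropy_at_infinity R M < d%:E)%E by rewrite h0 lte_fin /d; lra.
have [q aq /(limn_einf_lt 1)[m m0 gr]] := limn_einf_lt a.+1 hd.
have [k k0 Hk] := gsum_many_lty aq m0.
pose p := - P + Num.min k d.
have d0 : 0 < d by rewrite /d; lra.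
have pk : p <= - P + k by rewrite lerD2l ge_min lexx.
have pd : p <= - P + d by rewrite lerD2l ge_min lexx orbT.
exists p; first by rewrite ltrDl lt_min k0.
rewrite /loop_series (esumID (few_visits q m))//; last by move=> y _; exact: weighte_ge0.
rewrite lte_add_pinfty//; last exact: Hk.
by apply: (gsum_few_lty aq _ gr); rewrite /d in pd *; lra.
Qed.

End GapSPR.

Theorem theorem2p7 (R : realType) (M : rel nat) (phi : (nat -> nat) -> R)
    (a : nat)
    (Mtrans : topologically_transitive M)
    (phi_sv : summable_variations M phi)
    (P_fin : (pressure M phi a < +oo)%E)
    (h_inf0 : entropy_at_infinity R M = 0%E) :
  (chi_per M phi < pressure M phi a)%E <-> strongly_positive_recurrent M phi.
Proof.
have [B HB] := summable_variations_distortion phi_sv.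
have [P PE] : exists P : R, pressure M phi a = P%:E.
  exists (fine (pressure M phi a)); rewrite fineK// fin_real// P_fin andbT.
  exact: pressure_gtNy HB Mtrans _.
split=> [|[b [w [/induced_alphabetE rw]]]].
- rewrite PE => /lte_EFin_dense[X XP chiX].
  have [p Pp Gp] := first_return_gap HB Mtrans PE (ltW chiX) XP h_inf0.
  have [w [_ [rw _ _]]] := exists_two_returns a Mtrans.
  exists a, w; split; first exact/induced_alphabetE.
  by apply/(discriminant_gt0P HB PE rw); exists p.
- have PbE : pressure M phi b = P%:E by rewrite -PE; exact: pressure_base HB Mtrans _ _.
  move=> /(discriminant_gt0P HB PbE rw)[p Pp Gp].
  by rewrite PE; exact: (chi_per_lt_pressure HB Mtrans PbE Pp Gp).
Qed.
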